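(* Let $d\ge1$ be an integer and $n\in\mathbb{Z}$. Assume that the coupled system with $d$ second class particles is stationary and $\underline{\xi}\sim\underline{\nu}^n$. For any $\underline{m}=(m_1,\dots,m_d)\in\mathbb{Z}^d$ with $m_1<m_2<\dots<m_d$, the probability that the vector of positions $\underline X$ of the second class particles equals $\underline m$ is $$\mathbb{P}_{\underline{\nu}^n}(\underline{X}=\underline{m})=q^{-\sum_{i=1}^dm_i}(q;q)_\infty\prod_{i=1}^d(1-q^i)\sum_{\substack{\underline{k}\in Z_+^d:\\ k_j\geq m_j-n-1\ \forall j\in\{1,\dots,d\}}}\frac{q^{\frac{k_1(k_1+1)}{2}+k_1(d-m_1)+\frac{k_d(k_d+1)}{2}+(k_d+1)(n+1)}}{(q;q)_{n-m_d+k_d+1}(q;q)_{k_1}}\prod_{j=2}^dq^{\hat{k}_j(d+1-j-m_j)+\frac{\hat{k}_j(\hat{k}_j+1)}{2}}\begin{bmatrix}\hat{m}_j\\ \hat{k}_j\end{bmatrix}_q,$$ where $\hat{m}_j:=m_j-m_{j-1}-1$ and $\hat{k}_j:=k_j-k_{j-1}-1$ for each $j\in\{2,\dots,d\}$.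
   Context: Fix $q\in(0,1)$. $(q;q)_0=1$, $(q;q)_r=\prod_{i=1}^{r}(1-q^i)$, $(q;q)_\infty=\prod_{i=1}^\infty(1-q^i)$. The $q$-binomial coefficient is $\begin{bmatrix}a\\ b\end{bmatrix}_q=\prod_{i=0}^{b-1}\frac{1-q^{a-i}}{1-q^{i+1}}$ for integers $a,b\ge0$; it equals $\frac{(q;q)_a}{(q;q)_b(q;q)_{a-b}}$ for $b\le a$ and $0$ for $b>a$. $Z_+^d=\{\underline x\in\mathbb{Z}^d:0\le x_1<\dots<x_d\}$. For $c\in\mathbb{R}$, $\underline{\mu}^c$ is the product probability measure on $\{0,1\}^{\mathbb{Z}}$ under which the coordinates $z_i$ are independent with $\underline\mu^c(z_i=1)=\frac{q^{c-i}}{1+q^{c-i}}$. It is concentrated on the countable set $\Omega=\{\underline z\in\{0,1\}^{\mathbb{Z}}:\sum_{i\le0}z_i<\infty,\ \sum_{i\ge1}(1-z_i)<\infty\}$. For $\underline z\in\Omega$ let $N(\underline z)=\sum_{i=1}^\infty(1-z_i)-\sum_{i=-\infty}^0z_i$. For $n\in\mathbb{Z}$, $\underline\nu^n(\cdot)=\underline\mu^c(\,\cdot\mid N=n)$ (independent of $c$). ASEP: the Markov jump process $\underline\xi(t)$ on $\Omega$ in which, for every $i\in\mathbb{Z}$, a particle at $i$ jumps to $i+1$ at rate $1$ if $i+1$ is empty, and a particle at $i+1$ jumps to $i$ at rate $q$ if $i$ is empty. The label of a particle of $\underline\xi(t)$ is the number of particles of $\underline\xi(t)$ strictly to its left; labels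 are $0,1,2,\dots$. Coupled system with $d$ second class particles: the Markov process $(\underline\xi(t),\underline x(t))$ on $\Omega\times Z_+^d$ in which $\underline\xi(t)$ evolves as ASEP, and the label process $\underline x(t)$ evolves as follows: each coordinate $x_j$ becomes $x_j+1$ at rate $q$ if $x_j+1$ is not one of the coordinates of $\underline x$, and becomes $x_j-1$ at rate $1$ if $x_j-1\ge0$ and $x_j-1$ is not one of the coordinates; in either case the move is allowed only if the two particles of $\underline\xi(t)$ whose labels are the old and new values of $x_j$ occupy neighbouring sites. Let $X_j(t)$ be the site of the particle of $\underline\xi(t)$ with label $x_j(t)$; $X_1(t)<\dots<X_d(t)$ are the positions of the second class particles. Put $\underline\eta(t)=\underline\xi(t)-\sum_{j=1}^d\underline\delta_{X_j(t)}$, where $\underline\delta_i$ is the configuration with a single particle, at site $i$. The coupled system is stationary if the law of $(\underline\xi(t),\underline x(t))$ does not depend on $t$; $\underline\xi,\underline\eta,\underline x,\underline X$ denote the values at a fixed time. $\mathbb{P}_{\underline\nu^n}$ denotes probability when the coupled system is stationary with $\underline\xi\sim\underline\nu^n$. *)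

(* Defs.v *)
From HB Require Import structures.
From mathcomp Require Export all_boot all_order all_algebra.
From mathcomp Require Export all_classical all_reals all_analysis.
Export Order.TTheory GRing.Theory Num.Theory.
Export numFieldNormedType.Exports.

Set Implicit Arguments.
Unset Strict Implicit.
Unset Printing Implicit Defensive.

Global Open Scope classical_set_scope.
Global Open Scope ring_scope.

(** * q-notation *)

Definition qpoch (R : realType) (q : R) (r : nat) : R :=
  \prod_(1 <= i < r.+1) (1 - q ^+ i).

Definition qpoch_oo (R : realType) (q : R) : R := limn (qpoch q).

(* Meant for a, b >= 0 only, so that `|b| is b; the product vanishes when
   0 <= a < b because of the factor i = a. *)
Definition qbinom (R : realType) (q : R) (a b : int) : R :=
  \prod_(0 <= i < `|b|%N) ((1 - q ^ (a - i%:Z)) / (1 - q ^+ i.+1)).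

(* Coordinates numbered from 1: s_1, ..., s_d. *)
Definition co (s : seq int) (j : nat) : int := nth 0 s j.-1.

Definition hat (s : seq int) (j : nat) : int := co s j - co s j.-1 - 1.

Definition Zplus (d : nat) : set (d.-tuple int) :=
  [set x : d.-tuple int | sorted <%R x /\ all (fun i => 0 <= i) x].

Arguments Zplus : clear implicits.

(** * Particle configurations and their laws *)

Definition config := int -> bool.

(* Generators of the product sigma-algebra on {0,1}^Z. *)
Definition coordinate_events : set (set config) :=
  [set A : set config | exists i, A = [set z : config | z i]].

Definition configS := g_sigma_algebraType coordinate_events.

(* The sums of the 0/1 numbers z_i, i <= 0, and 1 - z_i, i >= 1, are finite. *)
Definition Omega : set config :=
  [set z : config | finite_set [set i | i <= 0 /\ z i]
                 /\ finite_set [set i | 1 <= i /\ ~~ z i]].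

Definition N (z : config) : int :=
  \sum_(i \in [set i : int | 1 <= i]) (1 - (z i : nat)%:Z)
  - \sum_(i \in [set i : int | i <= 0]) (z i : nat)%:Z.

Definition density (R : realType) (q c : R) (i : int) : R :=
  q `^ (c - i%:~R) / (1 + q `^ (c - i%:~R)).

(* These finite-dimensional marginals determine mu; the library has no
   infinite product measure. *)
Definition is_product_measure (R : realType) (q c : R)
    (mu : probability configS R) : Prop :=
  forall (F : seq int) (e : config), uniq F ->
    mu [set z : config | forall i, i \in F -> z i = e i] =
    (\prod_(i <- F) (if e i then density q c i else 1 - density q c i))%:E.

Definition N_event (n : int) : set config := Omega `&` [set z | N z = n].

(* The conditional law mu( . | N = n). *)
Definition nu (R : realType) (mu : probability configS R) (n : int)
    (A : set config) : \bar R :=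
  (fine (mu (A `&` N_event n)) / fine (mu (N_event n)))%:E.

(** * Markov jump processes *)

Section MarkovJumpProcess.
Variables (R : realType) (T : choiceType) (S : set T).

(* [rate a b] is the rate of the jump from [a] to [b <> a]; from each state
   only finitely many jumps are possible in the processes considered here,
   so that the sum below is an actual sum. *)
Definition generator (rate : T -> T -> R) (a b : T) : R :=
  if a == b then - \sum_(s \in S `\ a) rate a s else rate a b.

Definition transition_function (rate : T -> T -> R) (p : R -> T -> T -> R) :=
  [/\ forall t a b, 0 <= t -> S a -> S b -> 0 <= p t a b,
      forall t a, 0 <= t -> S a -> (\esum_(b in S) (p t a b)%:E = 1)%E,
      forall a b, S a -> S b -> p 0 a b = (a == b)%:R,
      forall s t a b, 0 <= s -> 0 <= t -> S a -> S b ->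
        (\esum_(u in S) (p s a u * p t u b)%:E = (p (s + t) a b)%:E)%E
    & forall a b, S a -> S b ->
        (p h a b - (a == b)%:R) / h @[h --> 0^'+] --> generator rate a b].

(* Only the values of [Y] at times t >= 0 are meaningful. *)
Definition markov_jump_process (dW : measure_display) (W : measurableType dW)
    (P : probability W R) (rate : T -> T -> R) (Y : R -> W -> T) : Prop :=
  [/\ forall t w, 0 <= t -> S (Y t w),
      forall t a, 0 <= t -> measurable [set w | Y t w = a],
      (* paths are right-continuous step functions *)
      forall t w, 0 <= t -> exists2 e, 0 < e &
        forall u, t <= u < t + e -> Y u w = Y t w,
      (* with finitely many jumps in bounded time intervals *)
      forall t w, 0 < t -> exists2 e, 0 < e & exists a,
        forall u, 0 <= u -> t - e < u < t -> Y u w = a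
    & exists2 p, transition_function rate p &
      (* Markov property, H listing finitely many past observations *)
      forall (H : seq (R * T)) (s h : R) (a b : T),
        0 <= s -> 0 <= h -> (forall u, u \in H -> 0 <= u.1 <= s) ->
        S a -> S b ->
        let past := [set w | forall u, u \in H -> Y u.1 w = u.2] in
        (P (past `&` [set w | Y s w = a] `&` [set w | Y (s + h)%R w = b]) =
         P (past `&` [set w | Y s w = a]) * (p h a b)%:E)%E].

Definition stationary (dW : measure_display) (W : measurableType dW)
    (P : probability W R) (Y : R -> W -> T) : Prop :=
  forall (s t : R) (A : set T), 0 <= s -> 0 <= t ->
    P [set w | A (Y s w)] = P [set w | A (Y t w)].

End MarkovJumpProcess.

(** * ASEP with second class particles *)

Definition swap (i : int) (z : config) : config := fun l =>
  if l == i then z (i + 1) else if l == i + 1 then z i else z l.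

(* For given [z], [z'] at most one site contributes to the sum. *)
Definition asep_rate (R : realType) (q : R) (z z' : config) : R :=
  \sum_(i \in [set: int])
    ((z i && ~~ z (i + 1))%:R + q * (~~ z i && z (i + 1))%:R)
    * (z' == swap i z)%:R.

Definition label (z : config) (i : int) : int :=
  \sum_(l \in [set l : int | l < i]) (z l : nat)%:Z.

(* The site of the particle with label k >= 0; it exists and is unique for
   z in Omega. *)
Definition site (z : config) (k : int) : int :=
  xget 0 [set i | z i /\ label z i = k].

Definition neighbours (z : config) (k k' : int) : bool :=
  `|site z k - site z k'| == 1.

Definition set_coord (d : nat) (x : d.-tuple int) (j : 'I_d) (k : int) :
  d.-tuple int := [tuple if i == j then k else tnth x i | i < d].

Definition label_rate (R : realType) (q : R) (d : nat) (z : config)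
    (x x' : d.-tuple int) : R :=
  \sum_(j < d)
    let k := tnth x j in
    (q * [&& k + 1 \notin x, neighbours z k (k + 1)
           & x' == set_coord x j (k + 1)]%:R
     + [&& 0 <= k - 1, k - 1 \notin x, neighbours z k (k - 1)
         & x' == set_coord x j (k - 1)]%:R).

Definition coupled_space (d : nat) : set (config * d.-tuple int) :=
  [set a | Omega a.1 /\ Zplus d a.2].

Arguments coupled_space : clear implicits.

Definition coupled_rate (R : realType) (q : R) (d : nat)
    (a b : config * d.-tuple int) : R :=
  asep_rate q a.1 b.1 * (a.2 == b.2)%:R
  + (a.1 == b.1)%:R * label_rate q a.1 a.2 b.2.

Definition coupled_system (R : realType) (q : R) (d : nat)
    (dW : measure_display) (W : measurableType dW) (P : probability W R)
    (xi : R -> W -> config) (x : R -> W -> d.-tuple int) : Prop :=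
  markov_jump_process (coupled_space d) P (@coupled_rate R q d)
    (fun t w => (xi t w, x t w)).

Definition positions (d : nat) (z : config) (x : d.-tuple int) :
  d.-tuple int := [tuple site z (tnth x j) | j < d].

(* Main.v *)
(** The weights rho(z, x) = mu{z} q^(x_1 + ... + x_d) are reversible for the
    coupled system.  Stationarity makes the law of the system superinvariant;
    as rho has finite total flux, the maximum principle forces the ratio of the
    law to rho to be constant along possible jumps.  From any state with N = n
    one reaches, by jumps of particles to the right and of labels downwards,
    the ground state with all sites > n occupied and labels 0, ..., d-1.  Hence
    the law is a multiple of rho on {N = n}, normalised by the marginal at the
    ground state, and given N = n the labels are independent of the
    configuration.  Then P(X = m) is a sum over labels k of mu(N = n, the
    particle with label k_j is at m_j for all j).  Adding a particle at an empty
    site i multiplies mu{z} by q^(c-i), so a window of L sites holding g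
    particles contributes a q-binomial coefficient; the windows between
    consecutive m_j give the product, and letting the outer windows grow gives
    the two q-Pochhammer symbols in the denominator and (q;q)_oo. *)
Require Import Defs.
From mathcomp Require Import zify ring lra.

Set Implicit Arguments.
Unset Strict Implicit.
Unset Printing Implicit Defensive.

(** * Superinvariant weights of a reversible jump process *)

(** Invariance of the law under the generator would require the derivative of [p] at time 0 to pass
    through an infinite sum over starting states, while only its entrywise existence is given.
    Finite partial sums do pass to the limit, and this leaves the inequality called superinvariance.
    An inequality alone does not exclude a leak; finite total flux does, because a truncation of the
    law below a multiple of rho has equal total inflow and outflow. The flux is finite since a
    change of occupation between i and i+1 has probability O(q^|i|) and the label weights are
    summable. No infinite product over the sites is evaluated. Each event inside {N = n} is measured
    in units of mu{[gs n]}, the mass of the ground state, and comparing [gs n] with [gs (n + g)]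
    cancels all powers of q^c. That mu{[gs n]} is positive is drawn from the law of [xi] having
    total mass 1. For given labels the pinned event directly yields only the bound k_d >= m_d - n -
    1; the bounds at the other indices come from q-binomials that vanish. *)

Section Esum.
Variable R : realType.
Local Open Scope ereal_scope.

Lemma ge0_esumZl (T : choiceType) (S : set T) (a : T -> \bar R) (c : R) :
  (forall i, S i -> 0 <= a i) -> (0 <= c)%R ->
  \esum_(i in S) (c%:E * a i) = c%:E * \esum_(i in S) a i.
Proof.
move=> a0; rewrite le_eqVlt => /orP[/eqP<-|c0].
  by rewrite mul0e esum1// => i _; rewrite mul0e.
(* One direction for every positive factor is enough: it is used with [c] on [a], then with the
   inverse of [c] on [c * a]. *)
have key (e : R) (b : T -> \bar R) : (0 < e)%R -> (forall i, S i -> 0 <= b i) ->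
    \esum_(i in S) (e%:E * b i) <= e%:E * \esum_(i in S) b i.
  move=> e0 b0; apply: ge_ereal_sup => _ [X [finX XS] <-].
  rewrite fsbig_finite// big_seq -ge0_sume_distrr; last first.
    by move=> i; rewrite in_fset_set// inE => /XS/b0.
  rewrite lee_pmul2l// ?ltry//; apply: esum_ge; exists X => //.
  by rewrite fsbig_finite// -big_seq.
apply/eqP; rewrite eq_le key//=.
have := @key c^-1%R (fun i => c%:E * a i); rewrite invr_gt0 => /(_ c0).
have -> : \esum_(i in S) (c^-1%:E * (c%:E * a i)) = \esum_(i in S) a i.
  by apply: eq_esum => i _; rewrite muleA -EFinM mulVf ?mul1e// gt_eqF.
move=> H; rewrite -(@lee_pmul2l _ (c^-1)%:E)// ?ltry ?lte_fin ?invr_gt0//.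
rewrite muleA -EFinM mulVf ?gt_eqF// mul1e; apply: H => i Si.
by rewrite mule_ge0 ?a0// lee_fin ltW.
Qed.

Lemma esum_exchange (T1 T2 : choiceType) (I : set T1) (J : set T2)
    (a : T1 -> T2 -> \bar R) :
  (forall i j, I i -> J j -> 0 <= a i j) ->
  \esum_(i in I) \esum_(j in J) a i j = \esum_(j in J) \esum_(i in I) a i j.
Proof.
move=> a0; rewrite (@esum_esum _ _ _ I (fun=> J))// [RHS](@esum_esum _ _ _ J (fun=> I)); last first.
  by move=> i j Jj Ii; exact: a0.
rewrite (@reindex_esum _ _ _ (J `*`` (fun=> I)) _ (fun k => (k.2, k.1)))//.
split; [by move=> [i j] [/= ? ?]| |by move=> [i j] [/= ? ?]; exists (j, i)].
by move=> [i j] [i' j'] _ _ /= [-> ->].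
Qed.

(** Finiteness of the larger sum lets the remainders be cancelled once the term at [i] is split off;
    two infinite sums would say nothing about their terms. *)
Lemma esum_le_eq (T : choiceType) (S : set T) (u v : T -> \bar R) :
  (forall i, S i -> 0 <= u i) -> (forall i, S i -> u i <= v i) ->
  \esum_(i in S) v i < +oo ->
  \esum_(i in S) u i = \esum_(i in S) v i ->
  forall i, S i -> u i = v i.
Proof.
move=> u0 uv vfin uvE i Si.
have v0 j : S j -> 0 <= v j by move=> Sj; exact: le_trans (u0 j Sj) (uv j Sj).
have SiE : S `&` [set i] = [set i] by apply/seteqP; split => [j []//|j ->].
move: uvE; rewrite (esumID [set i] S u)// (esumID [set i] S v)// SiE.
rewrite !esum_set1 ?u0 ?v0//.
move: (esumID [set i] S v v0); rewrite SiE esum_set1 ?v0// => vE.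
have r : \esum_(j in S `&` ~` [set i]) u j <= \esum_(j in S `&` ~` [set i]) v j.
  by apply: le_esum => j [/uv].
have ru0 : 0 <= \esum_(j in S `&` ~` [set i]) u j.
  by apply: esum_ge0 => j [/u0].
move=> e; move: vfin; rewrite vE => vfin.
have rv0 := le_trans ru0 r.
have /fineK vf : v i \is a fin_num.
  by rewrite ge0_fin_numE ?v0// (le_lt_trans _ vfin)// leeDl.
have rf : \esum_(j in S `&` ~` [set i]) v j \is a fin_num.
  by rewrite ge0_fin_numE// (le_lt_trans _ vfin)// leeDr// v0.
have rf' : \esum_(j in S `&` ~` [set i]) u j \is a fin_num.
  by rewrite ge0_fin_numE// (le_lt_trans r)// -ge0_fin_numE.
have uf : u i \is a fin_num.
  by rewrite ge0_fin_numE ?u0// (le_lt_trans (uv i Si))// -vf ltry.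
move: e r (uv i Si); rewrite -vf -(fineK rf) -(fineK rf') -(fineK uf) -!EFinD !lee_fin.
by move=> [e] r1 r2; congr EFin; lra.
Qed.

(* Truncating [lam] at a multiple of the reversible measure [rho] keeps it
   superinvariant and makes the total flux finite, so that the truncation is
   invariant; at a state where it touches [M * rho] this is the equality case
   of the maximum principle. *)
Lemma superinvariant_const (T : choiceType) (S : set T) (r : T -> T -> R)
    (rho lam : T -> R) :
  (forall a b, (0 <= r a b)%R) ->
  (forall a, S a -> (0 < rho a)%R) -> (forall a, S a -> (0 <= lam a)%R) ->
  (forall a b, S a -> S b -> (rho a * r a b = rho b * r b a)%R) ->
  \esum_(a in S) \esum_(b in S) (rho a * r a b)%:E < +oo ->
  (forall b, S b -> \esum_(a in S) (lam a * r a b)%:E <=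
     (lam b)%:E * \esum_(a in S) (r b a)%:E) ->
  forall a b, S a -> S b -> (0 < r a b)%R -> (lam a / rho a = lam b / rho b)%R.
Proof.
move=> r0 rho0 lam0 rev fin sup.
(* By reversibility [r b a] is positive along with [r a b], so one inequality per directed edge
   suffices. *)
suff H a b : S a -> S b -> (0 < r a b)%R -> (lam b / rho b <= lam a / rho a)%R.
  move=> a b Sa Sb rab; apply/eqP; rewrite eq_le !H//.
  rewrite -(pmulr_rgt0 _ (rho0 b Sb)) rev// mulr_gt0 ?rho0//.
move=> Sa Sb rab.
(* At this level the truncation [lM] touches [M * rho] at [b]. *)
set M := (lam b / rho b)%R.
have M0 : (0 <= M)%R by rewrite divr_ge0 ?lam0// ltW ?rho0.
have Mb : (M * rho b = lam b)%R by rewrite divfK// gt_eqF ?rho0.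
pose lM c := Num.min (lam c) (M * rho c)%R.
have lM0 c : S c -> (0 <= lM c)%R.
  by move=> Sc; rewrite le_min lam0//= mulr_ge0// ltW ?rho0.
have lMb : lM b = lam b by rewrite /lM Mb minxx.
have rs c : S c -> \esum_(a in S) (M * rho a * r a c)%:E =
    (M * rho c)%:E * \esum_(a in S) (r c a)%:E.
  move=> Sc; rewrite -ge0_esumZl; last 2 first.
  - by move=> d _; rewrite lee_fin.
  - by rewrite mulr_ge0// ltW// rho0.
  apply: eq_esum => d Sd; rewrite -EFinM; congr EFin.
  by rewrite -!mulrA rev.
(* A minimum of two superinvariant functions is superinvariant; [M * rho] is one of them by [rs]. *)
have lMsup e : S e -> \esum_(a in S) (lM a * r a e)%:E <=
    (lM e)%:E * \esum_(a in S) (r e a)%:E.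
  move=> Se; have [h|h] := leP (lam e) (M * rho e)%R.
    have -> : lM e = lam e by rewrite /lM min_l.
    apply: le_trans (sup e Se); apply: le_esum => d Sd.
    by rewrite lee_fin ler_wpM2r// ge_min lexx.
  have -> : lM e = (M * rho e)%R by rewrite /lM min_r// ltW.
  rewrite -rs//; apply: le_esum => d Sd.
  by rewrite lee_fin ler_wpM2r// ge_min lexx orbT.
(* Both sides are the total flux, grouped by the state left or by the state entered. With [totfin],
   the termwise inequality [lMsup] must then be an equality. *)
have tot : \esum_(c in S) ((lM c)%:E * \esum_(a in S) (r c a)%:E) =
    \esum_(c in S) \esum_(a in S) (lM a * r a c)%:E.
  rewrite esum_exchange; last by move=> i j _ Sj; rewrite lee_fin mulr_ge0// lM0.
  apply: eq_esum => c Sc; rewrite -ge0_esumZl ?lM0//.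
  by move=> d _; rewrite lee_fin.
have totfin : \esum_(c in S) ((lM c)%:E * \esum_(a in S) (r c a)%:E) < +oo.
  apply: (@le_lt_trans _ _ (M%:E * \esum_(a in S) \esum_(b in S) (rho a * r a b)%:E)).
    rewrite -ge0_esumZl//; last first.
      move=> i Si; apply: esum_ge0 => j _.
      by rewrite lee_fin mulr_ge0// ltW// rho0.
    apply: le_esum => c Sc.
    have -> : \esum_(b in S) (rho c * r c b)%:E = (rho c)%:E * \esum_(b in S) (r c b)%:E.
      by rewrite -ge0_esumZl ?ltW ?rho0// => d _; rewrite lee_fin.
    rewrite muleA -EFinM lee_wpmul2r//.
      by apply: esum_ge0 => d _; rewrite lee_fin.
    by rewrite lee_fin ge_min lexx orbT.
  by rewrite lte_mul_pinfty.
have eqb := @esum_le_eq _ S _ _ _ lMsup totfin (esym tot) b Sb.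
have /eqb {}eqb : forall i, S i -> 0 <= \esum_(a in S) (lM a * r a i)%:E.
  by move=> i _; apply: esum_ge0 => d Sd; rewrite lee_fin mulr_ge0// lM0.
(* Second equality case, for the flux into [b]: [lM] and the larger [M * rho] have equal inflow, so
   the terms agree, and the edge from [a] forces [lM a = M * rho a]. *)
have := @esum_le_eq _ S (fun a => (lM a * r a b)%:E) (fun a => (M * rho a * r a b)%:E).
rewrite rs// eqb lMb Mb => E.
have /E{E} : forall i, S i -> 0 <= (lM i * r i b)%:E.
  by move=> d Sd; rewrite lee_fin mulr_ge0// lM0.
have leM : forall i, S i -> (lM i * r i b)%:E <= (M * rho i * r i b)%:E.
  by move=> d Sd; rewrite lee_fin ler_wpM2r// ge_min lexx orbT.
move=> /(_ leM); rewrite -{1}lMb => E.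
have lt : ((lM b)%:E * (\esum_(a0 in S) (r b a0)%:E) < +oo)%E.
  apply: le_lt_trans totfin; apply: esum_ge; exists [set b].
    by split=> // _ ->.
  by rewrite fsbig_set1.
have [/(mulIf (lt0r_neq0 rab)) lMa] := E lt erefl a Sa.
have : (M * rho a <= lam a)%R by rewrite -lMa ge_min lexx.
by rewrite ler_pdivlMr ?rho0.
Qed.

End Esum.

(** [T] is a bare type without sigma-algebra; an injection of [A] into the naturals writes the
    preimage as a countable disjoint union of measurable sets. *)
Lemma measure_preimage_esum (dW : measure_display) (W : measurableType dW)
    (R : realType) (P : {measure set W -> \bar R}) (T : choiceType)
    (Y : W -> T) (A : set T) :
  countable A -> (forall a, A a -> measurable [set w | Y w = a]) ->
  P [set w | A (Y w)] = (\esum_(a in A) P [set w | Y w = a])%E.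
Proof.
move=> /countable_injP[f finj] mY.
have YE : [set w | A (Y w)] = \bigcup_(k in f @` A) [set w | A (Y w) /\ f (Y w) = k].
  by apply/seteqP; split => [w Aw|w [k _ []//]]; exists (f (Y w)) => //; exists (Y w).
have fE a : A a -> [set w | A (Y w) /\ f (Y w) = f a] = [set w | Y w = a].
  move=> Aa; apply/seteqP; split => [w [Aw /finj]|w /= -> //].
  by rewrite !inE; exact.
rewrite YE measure_bigcup.
- rewrite nneseries_esum; last by move=> *; exact: measure_ge0.
  rewrite set_mem_set esum_image//.
  by apply: eq_esum => a Aa; rewrite fE.
- by move=> _ [a Aa <-]; rewrite fE//; exact: mY.
- by move=> i j _ _ [w [[_ <-] [_ <-]]].
Qed.

(** Being at some [a] of [F] at time [t] and at [b] at time [t + h] are disjoint parts of being at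
    [b] at time [t + h], whose probability stationarity carries back to [t]. A finite [F] allows a
    limit in [h] term by term. *)
Lemma transition_le_invariant (R : realType) (T : choiceType) (S : set T)
    (dW : measure_display) (W : measurableType dW) (P : probability W R)
    (rate : T -> T -> R) (Y : R -> W -> T) :
  markov_jump_process S P rate Y -> stationary P Y ->
  exists2 p, transition_function S rate p & forall (t h : R) (F : set T) b,
    0 <= t -> 0 <= h -> finite_set F -> F `<=` S -> S b ->
    \sum_(a \in F) fine (P [set w | Y t w = a]) * p h a b <=
    fine (P [set w | Y t w = b]).
Proof.
move=> [YS mY _ _ [p tp mk]] st; exists p => // t h F b t0 h0 finF FS Sb.
have th0 : 0 <= t + h by rewrite addr_ge0.
have Pb : P [set w | Y t w = b] = P [set w | Y (t + h) w = b].
  by have := st t (t + h) [set b] t0 th0.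
rewrite -lee_fin fineK ?fin_num_measure//; last exact: mY.
rewrite Pb -fsumEFin//.
have mI a : measurable ([set w | Y t w = a] `&` [set w | Y (t + h) w = b]).
  by apply: measurableI; apply: mY.
have -> : (\sum_(a \in F) (fine (P [set w | Y t w = a]) * p h a b)%:E =
    \sum_(a \in F) P ([set w | Y t w = a] `&` [set w | Y (t + h)%R w = b]))%E.
  apply: eq_fsbigr => a; rewrite inE => Fa.
  (* The Markov property with empty history. *)
  have := mk [::] t h a b t0 h0; rewrite /= => /(_ _ (FS a Fa) Sb).
  have -> : [set w : W | forall u : R * T, u \in [::] -> Y u.1 w = u.2] = setT.
    by apply/seteqP; split.
  by rewrite !setTI EFinM fineK ?fin_num_measure//; [move=> ->|exact: mY].
rewrite -esum_fset//.
pose Z w := (Y t w, Y (t + h) w).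
have -> : (\esum_(a in F) P ([set w | Y t w = a] `&` [set w | Y (t + h)%R w = b]) =
    \esum_(u in (fun a => (a, b)) @` F) P [set w | Z w = u])%E.
  rewrite esum_image; last by move=> x y _ _ [].
  apply: eq_esum => a _; congr (P _).
  by apply/seteqP; split => w /=; rewrite /Z; [case=> -> ->|case].
rewrite -measure_preimage_esum.
- apply: le_measure; rewrite ?inE; last 2 first.
  + exact: mY.
  + by move=> w /= [a _ [_ <-]].
  rewrite [X in measurable X](_ : _ = \bigcup_(a in F)
     ([set w | Y t w = a] `&` [set w | Y (t + h) w = b])).
    by apply: fin_bigcup_measurable.
  apply/seteqP; split => w /=; first by move=> [a Fa [e1 e2]]; exists a.
  by move=> [a Fa [/= e1 e2]]; exists a => //; rewrite /Z e1 e2.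
- by apply: finite_set_countable; apply: finite_image.
move=> _ [a Fa <-].
rewrite [X in measurable X](_ : _ = [set w | Y t w = a] `&` [set w | Y (t + h) w = b])//.
by apply/seteqP; split => w /=; rewrite /Z; [case|case=> -> ->].
Qed.

(** The term of [b] is moved to the right, the inequality is divided by [h], and [h] decreases to 0;
    the supremum over finite sets is taken outside, so no limit is exchanged with an infinite
    sum. *)
Lemma superinvariant (R : realType) (T : choiceType) (S : set T)
    (dW : measure_display) (W : measurableType dW) (P : probability W R)
    (rate : T -> T -> R) (Y : R -> W -> T) (t : R) (b : T) :
  markov_jump_process S P rate Y -> stationary P Y ->
  (forall a b, 0 <= rate a b) -> (forall a, S a -> rate a a = 0) ->
  (forall a, S a -> finite_set [set b | S b /\ rate a b != 0]) ->
  0 <= t -> S b ->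
  (\esum_(a in S) (fine (P [set w | Y t w = a]) * rate a b)%:E <=
  (fine (P [set w | Y t w = b]))%:E * \esum_(a in S) (rate b a)%:E)%E.
Proof.
move=> mY st r0 raa rfin t0 Sb.
have [p [_ _ _ _ plim] le] := transition_le_invariant mY st.
set lam := fun a => fine (P [set w | Y t w = a]).
(* [generator] uses a sum that is 0 on infinite support, the claim a sum in the extended reals; they
   agree because finitely many jumps leave [b] and [rate b b] is 0. *)
have exitE : (\esum_(a in S) (rate b a)%:E =
    (\sum_(s \in S `\ b) rate b s)%:E)%E.
  rewrite fsbig_supp -fsumEFin; last first.
    apply: sub_finite_set (rfin b Sb) => s [[Ss _] /= /eqP]; by split.
  rewrite -esum_fset; last 2 first.
  - by apply: sub_finite_set (rfin b Sb) => s [[Ss _] /= /eqP]; split.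
  - by move=> i _; rewrite lee_fin.
  rewrite [LHS]esum_mkcond [RHS]esum_mkcond; apply: eq_esum => s _.
  case: ifPn => sS; last by rewrite ifN// notin_setE/= => -[[/mem_set]]; rewrite (negPf sS).
  case: ifPn => //; rewrite notin_setE/= => h; congr EFin.
  have [->|sb] := eqVneq s b; first exact: raa.
  apply: contrapT => rs; apply: h; split => //; split; first exact: set_mem.
  exact/eqP.
rewrite exitE -EFinM; apply: ge_ereal_sup => _ [F [finF FS] <-].
rewrite fsumEFin// lee_fin.
have -> : \sum_(a \in F) lam a * rate a b = \sum_(a \in F `\ b) lam a * rate a b.
  apply/esym/fsbig_widen; first by move=> a [].
  move=> a [Fa /not_andP[]//= /contrapT ->]; by rewrite raa// mulr0.
set G := F `\ b.
have finG : finite_set G by apply: sub_finite_set finF => a [].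
have GS : G `<=` S by move=> a [/FS].
apply: (@ler_cvg_to R (0^'+) _ _ (fun h => \sum_(a \in G) lam a * ((p h a b - (a == b)%:R) / h))
   (fun h => - (lam b * ((p h b b - 1) / h)))).
- under eq_fun do rewrite fsbig_finite// big_seq.
  rewrite fsbig_finite// big_seq; apply: cvg_big; first exact: add_continuous.
  move=> a; rewrite in_fset_set// inE => -[Fa /eqP ab]; apply: cvgM; first exact: cvg_cst.
  by have := plim a b (FS a Fa) Sb; rewrite /generator (negPf ab).
- rewrite [X in _ --> X](_ : _ = - (lam b * - \sum_(s \in S `\ b) rate b s));
    last by rewrite mulrN opprK.
  apply: cvgN; apply: cvgM; first exact: cvg_cst.
  by have := plim b b Sb Sb; rewrite /generator eqxx.
near=> h.
have h0 : 0 < h by near: h; exact: nbhs_right_gt.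
have finbG : finite_set (b |` G) by rewrite finite_setU.
have bGS : b |` G `<=` S by move=> a [->//|/GS].
(* Adjoining [b] brings in [p h b b], which becomes [p h b b - 1] when the right-hand side is
   subtracted. *)
have := le t h _ b t0 (ltW h0) finbG bGS Sb.
rewrite (fsbigD1 b)//=; last by left.
have -> : (b |` G) `\ b = G.
  apply/seteqP; split => a.
    by move=> [[->|//]] /=.
  by move=> Ga; split; [right|case: Ga].
rewrite -/(lam b) => leb.
have -> : \sum_(a \in G) lam a * ((p h a b - (a == b)%:R) / h) =
    (\sum_(a \in G) lam a * p h a b) / h.
  rewrite mulr_fsuml; apply: eq_fsbigr => a; rewrite inE => -[_ /eqP/negPf ->].
  by rewrite subr0 mulrA.
rewrite -mulrN -mulNr mulrA ler_pM2r ?invr_gt0//.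
move: leb; rewrite /lam; nra.
Unshelve. all: by end_near.
Qed.

(** * Configurations, labels and sites *)

Section FiniteSums.
Variables (T : choiceType) (V : zmodType).
Implicit Types (D : set T) (F G : T -> V).

(** The finiteness hypothesis matters: a sum with infinite support takes the default value 0. *)
Lemma fsum_D1 D F i : finite_set (D `&` F @^-1` [set~ 0]) -> D i ->
  \sum_(l \in D) F l = F i + \sum_(l \in D `\ i) F l.
Proof.
(* [F i] may vanish, so [i] is adjoined to the support. *)
move=> finF Di; pose X := i |` (D `&` F @^-1` [set~ 0]).
have finX : finite_set X by rewrite finite_setU.
have XD : X `<=` D by move=> l [->|[]].
have e E : E `<=` D -> \sum_(l \in X `&` E) F l = \sum_(l \in E) F l.
  move=> ED; apply: fsbig_widen => [l []//|l [El /not_andP[]]]; last by [].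
  by move=> h; apply: contrapT => Fl; apply: h; right; split => //; apply: ED.
have := e D; rewrite (setIidl XD) => <-//; rewrite (fsbigD1 i)//; last by left.
rewrite -(e (D `\ i)); last by move=> l [].
congr (_ + _); apply: eq_fsbigl; apply/seteqP; split => l.
  by move=> [Xl li]; split => //; split => //; exact: XD.
by move=> [Xl [_ li]].
Qed.

Lemma fsum_update D F G i : finite_set (D `&` F @^-1` [set~ 0]) -> D i ->
  (forall l, l != i -> G l = F l) ->
  \sum_(l \in D) G l = \sum_(l \in D) F l + (G i - F i).
Proof.
move=> finF Di GF.
have finG : finite_set (D `&` G @^-1` [set~ 0]).
  apply: (@sub_finite_set _ _ (i |` (D `&` F @^-1` [set~ 0]))); last first.
    by rewrite finite_setU.
  move=> l [Dl /= Gl]; have [->|li] := eqVneq l i; first by left.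
  by right; split => //=; rewrite -GF.
rewrite (fsum_D1 finF Di) (fsum_D1 finG Di) addrAC addrCA subrr addr0.
congr (_ + _); apply: eq_fsbigr => l; rewrite inE => -[_ /eqP li].
exact: GF.
Qed.

End FiniteSums.

Lemma int_bounded (D : set int) : finite_set D ->
  exists2 B : int, 0 <= B & forall i, D i -> - B <= i <= B.
Proof.
move=> finD; exists (\sum_(i \in D) `|i|) => [|i Di].
  by apply: fsumr_ge0.
rewrite -ler_norml (fsbigD1 i)//=.
by rewrite lerDl fsumr_ge0.
Qed.

Lemma finite_itv_int (a b : int) : finite_set [set i : int | a <= i <= b].
Proof.
apply: (@sub_finite_set _ _ ((fun k : nat => a + k%:Z) @` `I_(`|b - a|.+1))).
  by move=> i /= iab; exists `|i - a|%N => /=; lia.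
by apply: finite_image; apply: finite_II.
Qed.

Lemma int_lt_ind (P : int -> Prop) (a : int) :
  P a -> (forall i, a <= i -> P i -> P (i + 1)) -> forall i, a <= i -> P i.
Proof.
move=> Pa PS i ai; have -> : i = a + `|i - a|%N%:Z by lia.
elim: `|i - a|%N => [|k IH]; first by rewrite addr0.
have -> : a + k.+1%:Z = a + k%:Z + 1 by lia.
by apply: PS => //; lia.
Qed.

Implicit Types z : config.

Definition addp (i : int) (z : config) : config := fun l => (l == i) || z l.
Definition remp (i : int) (z : config) : config := fun l => (l != i) && z l.
(** The ground state: no particle can jump to the right, and the strict inequality gives
    [N (gs a) = a]. *)
Definition gs (a : int) : config := fun l => a < l.

Lemma addpK i z : ~~ z i -> remp i (addp i z) = z.
Proof.
move=> zi; apply/funext => l; rewrite /remp /addp.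
by have [->|] //= := eqVneq l i; rewrite (negPf zi).
Qed.

Lemma rempK i z : z i -> addp i (remp i z) = z.
Proof.
move=> zi; apply/funext => l; rewrite /remp /addp.
by have [->|] //= := eqVneq l i.
Qed.

Lemma gs_addp a : gs a = addp (a + 1) (gs (a + 1)).
Proof. by apply/funext => l; rewrite /gs /addp; lia. Qed.

(** Finite distance from the step configuration [gs 0]; in this form, changes at finitely many sites
    visibly stay in [Omega]. *)
Lemma OmegaE z : Omega z <-> finite_set [set i | z i != (0 < i)].
Proof.
have -> : [set i | z i != (0 < i)] =
    [set i | i <= 0 /\ z i] `|` [set i | 1 <= i /\ ~~ z i].
  apply/seteqP; split => i /=.
    by have [i0|i0] := leP i 0; case: (z i) => //= _; [left|right]; split=> //; lia.
  by case=> -[h]; [move=> ->|move=> /negPf->]; lia.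
by rewrite finite_setU.
Qed.

Lemma Omega_eq_off (z z' : config) (D : set int) : finite_set D ->
  (forall l, ~ D l -> z l = z' l) -> Omega z -> Omega z'.
Proof.
move=> finD zz' /OmegaE fz; apply/OmegaE.
apply: (@sub_finite_set _ _ (D `|` [set i | z i != (0 < i)])); last first.
  by rewrite finite_setU.
move=> l /=; have [Dl|nDl] := pselect (D l); first by left.
by rewrite -zz'//; right.
Qed.

Lemma Omega_addp i z : Omega (addp i z) <-> Omega z.
Proof.
by split; apply: (@Omega_eq_off _ _ [set i]) => // l /= /eqP/negPf;
   rewrite /addp => ->.
Qed.

Lemma Omega_remp i z : Omega (remp i z) <-> Omega z.
Proof.
by split; apply: (@Omega_eq_off _ _ [set i]) => // l /= /eqP;
   rewrite /remp => ->.
Qed.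

Lemma Omega_gs a : Omega (gs a).
Proof.
apply/OmegaE; apply: sub_finite_set (@finite_itv_int (Num.min a 0) (Num.max a 0)).
by move=> i /=; rewrite /gs; lia.
Qed.

Lemma Omega_bounds z : Omega z ->
  exists2 B : int, 0 <= B & (forall i, i < - B -> ~~ z i) /\ (forall i, B < i -> z i).
Proof.
move=> /OmegaE /int_bounded[B B0 h]; exists B => //; split => i iB.
  have := h i; rewrite /=; case: (z i) => //= h'.
  by have : - B <= i <= B by [apply: h'; lia]; lia.
have := h i; rewrite /=; case: (z i) => //= h'.
by have : - B <= i <= B by [apply: h'; lia]; lia.
Qed.

Lemma Omega_fin_left z (D : set int) b : Omega z -> (forall l, D l -> l <= b) ->
  finite_set (D `&` (fun l => (z l : nat)%:Z) @^-1` [set~ 0]).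
Proof.
move=> /Omega_bounds[B B0 [h _]] Db.
apply: sub_finite_set (@finite_itv_int (- B) b) => l [/Db lb /=].
have := h l; case: (z l) => //= h' _; apply/andP; split => //.
by have [lB|//] := ltP l (- B); have := h' lB.
Qed.

Lemma Omega_fin_right z : Omega z ->
  finite_set ([set i : int | 1 <= i] `&` (fun l => 1 - (z l : nat)%:Z) @^-1` [set~ 0]).
Proof.
move=> /Omega_bounds[B B0 [_ h]].
apply: sub_finite_set (@finite_itv_int 1 B) => l [/= l1].
have := h l; case: (z l) => //= h' _; apply/andP; split => //.
by have [//|lB] := leP l B; have := h' lB.
Qed.

Lemma N_addp i z : Omega z -> ~~ z i -> N (addp i z) = N z - 1.
Proof.
move=> Oz zi; rewrite /N.
have off l : l != i -> addp i z l = z l by rewrite /addp => /negPf->.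
have on : addp i z i = true by rewrite /addp eqxx.
have [i0|i0] := leP i 0.
  rewrite (@fsum_update _ _ [set i : int | i <= 0] (fun l => (z l : nat)%:Z) _ i)//; last 2 first.
  - exact: (@Omega_fin_left z _ 0).
  - by move=> l li; rewrite off.
  rewrite on (negPf zi) subr0 opprD addrA; congr (_ - _ - _).
  by apply: eq_fsbigr => l; rewrite inE /= => l1; rewrite off//; lia.
rewrite (@fsum_update _ _ [set i : int | 1 <= i] (fun l => 1 - (z l : nat)%:Z) _ i)//; last 2 first.
- exact: Omega_fin_right.
- by move=> l li; rewrite off.
rewrite on (negPf zi) subr0 subrr sub0r addrAC; congr (_ - _ - _).
by apply: eq_fsbigr => l; rewrite inE /= => l1; rewrite off//; lia.
Qed.

Lemma N_remp i z : Omega z -> z i -> N (remp i z) = N z + 1.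
Proof.
move=> Oz zi; rewrite -{2}(rempK zi) N_addp ?subrK//; first exact/Omega_remp.
by rewrite /remp eqxx.
Qed.

Lemma N_gs a : N (gs a) = a.
Proof.
have gsS b : N (gs b) = N (gs (b + 1)) - 1.
  by rewrite {1}gs_addp N_addp//; [exact: Omega_gs|rewrite /gs ltxx].
have gs0 : N (gs 0) = 0.
  rewrite /N !fsbig1 ?subr0// => i /=; rewrite /gs; first by case: ltP.
  by have := gtz0_ge1 i; case: (0 < i) => //= <-.
have pos (k : nat) : N (gs k%:Z) = k%:Z.
  by elim: k => // k IH; have := gsS k%:Z; rewrite IH; have -> : k%:Z + 1 = k.+1%:Z by [lia]; lia.
have neg (k : nat) : N (gs (- k%:Z)) = - k%:Z.
  elim: k => [|k IH]; first by rewrite oppr0.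
  have := gsS (- k.+1%:Z); have -> : - k.+1%:Z + 1 = - k%:Z by lia.
  by rewrite IH; lia.
case: (lerP 0 a) => a0.
  by have := pos `|a|%N; have -> : `|a|%N%:Z = a by lia.
by have := neg `|a|%N; have -> : - `|a|%N%:Z = a by lia.
Qed.

Lemma labelS z i : Omega z -> label z (i + 1) = label z i + (z i : nat)%:Z.
Proof.
move=> Oz; rewrite /label (@fsum_D1 _ _ [set l : int | l < i + 1] _ i) /=; last 2 first.
- by apply: (@Omega_fin_left z _ i) => // l /=; lia.
- lia.
rewrite addrC; congr (_ + _); apply: eq_fsbigl; apply/seteqP; split => l /=.
  by move=> [h /eqP]; lia.
by move=> h; split; [lia|move=> e; move: h; rewrite e ltxx].
Qed.

Lemma label_addp z i l : Omega z -> ~~ z i ->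
  label (addp i z) l = label z l + ((i < l)%R : nat)%:Z.
Proof.
move=> Oz zi; rewrite /label.
have off k : k != i -> addp i z k = z k by rewrite /addp => /negPf->.
have [il|il] := ltP i l; last first.
  rewrite addr0; apply: eq_fsbigr => k; rewrite inE /= => kl.
  by rewrite off//; lia.
rewrite (@fsum_update _ _ [set l0 : int | l0 < l] (fun l => (z l : nat)%:Z) _ i)//; last 2 first.
- by apply: (@Omega_fin_left z _ l) => // k /= /ltW.
- by move=> k ki; rewrite off.
by rewrite /addp eqxx (negPf zi).
Qed.

Lemma label_eq0 z a : (forall i, i < a -> ~~ z i) -> label z a = 0.
Proof. by move=> h; rewrite /label fsbig1// => l /= /h /negPf->. Qed.

Lemma label_homo z i j : Omega z -> i <= j -> label z i <= label z j.
Proof.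
move=> Oz; move: j; apply: int_lt_ind => // j _ h.
by rewrite labelS// (le_trans h)// lerDl.
Qed.

Lemma label_lt z i j : Omega z -> z i -> i < j -> label z i < label z j.
Proof.
move=> Oz zi ij; apply: (@lt_le_trans _ _ (label z (i + 1))).
  by rewrite labelS// zi ltrDl.
by apply: label_homo => //; lia.
Qed.

Lemma label_ge0 z i : 0 <= label z i.
Proof. by apply: fsumr_ge0 => l _. Qed.

(** Discrete intermediate values: [label z] starts at 0, grows by 0 or 1 per site and is unbounded,
    so just before it first exceeds [k] sits a particle with label [k]. *)
Lemma site_exists z (k : int) : Omega z -> 0 <= k -> exists2 i, z i & label z i = k.
Proof.
move=> Oz k0; have [B B0 [zl zr]] := Omega_bounds Oz.
have big : exists j, k < label z (- B + j%:Z).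
  exists (`|B| + `|B| + `|k| + 2)%N.
  have : forall i, B + 1 <= i -> i - (B + 1) <= label z i.
    apply: int_lt_ind; first by rewrite subrr label_ge0.
    by move=> i Bi h; rewrite labelS// zr; lia.
  by move=> /(_ (- B + (`|B| + `|B| + `|k| + 2)%N%:Z)); lia.
case: (ex_minnP big) => j kj jmin.
case: j kj jmin => [|j] kj jmin.
  by move: kj; rewrite addr0 label_eq0// ltNge k0.
have lj : label z (- B + j%:Z) <= k.
  by rewrite leNgt; apply/negP => /jmin; rewrite ltnn.
move: kj; have -> : - B + j.+1%:Z = - B + j%:Z + 1 by lia.
rewrite labelS// => kj; exists (- B + j%:Z); first by case: (z _) kj => //; lia.
by case: (z _) kj; lia.
Qed.

(** Existence, together with strict growth of labels past each particle, makes [site z] a genuine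
    inverse of [label z] on particles. *)
Lemma siteP z (k i : int) : Omega z -> 0 <= k -> (site z k = i) <-> (z i /\ label z i = k).
Proof.
move=> Oz k0; have ex : exists i, z i /\ label z i = k.
  by have [j] := site_exists Oz k0; exists j.
have spec : z (site z k) /\ label z (site z k) = k.
  rewrite /site; case: ex => j hj; have := @xgetPex _ 0 [set i | z i /\ label z i = k].
  by apply; exists j.
split=> [<-//|[zi li]]; case: spec => zs ls.
case: (ltgtP (site z k) i) => // h.
  by have := label_lt Oz zs h; lia.
by have := label_lt Oz zi h; lia.
Qed.

Lemma label_gs a i : a < i -> label (gs a) i = i - a - 1.
Proof.
move=> ai; have := @int_lt_ind (fun i => label (gs a) i = i - a - 1) (a + 1).
apply; last by lia.
  rewrite label_eq0 ?addrK ?subrr//; last by move=> l; rewrite /gs; lia.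
  by lia.
move=> j aj lj; rewrite labelS ?lj; last exact: Omega_gs.
have -> : gs a j by rewrite /gs; lia.
by lia.
Qed.

Lemma site_gs (a k : int) : 0 <= k -> site (gs a) k = a + 1 + k.
Proof.
move=> k0; apply: (siteP _ (Omega_gs a) k0).2.
by split; [rewrite /gs; lia|rewrite label_gs; lia].
Qed.

(** * The product measure *)

(** A configuration is coded by the finite list of sites where it differs from the step
    configuration; [(+)] is exclusive or. *)
Lemma countable_Omega : countable Omega.
Proof.
pose f (s : seq int) : config := fun i => (0 < i) (+) (i \in s).
apply: (@sub_countable _ _ _ (f @` setT)); last first.
  by apply: sub_countable (card_image_le f setT) _; exact: countableP.
apply: subset_card_le => z /OmegaE/finite_seqP[s zs].
exists s => //; apply/funext => i; rewrite /f.
have : [set i | z i != (0 < i)] i <-> [set` s] i by rewrite zs.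
rewrite /=; case: (z i) (0 < i) (i \in s) => [] [] [] //= [h1 h2];
  by [have := h1 isT|have := h2 isT].
Qed.

Definition window (B : nat) : seq int := [seq k%:Z - B%:Z | k <- iota 0 (B + B).+1].

Lemma window_uniq B : uniq (window B).
Proof. by rewrite map_inj_uniq ?iota_uniq// => i j; lia. Qed.

Lemma mem_window B (i : int) : (i \in window B) = (- B%:Z <= i <= B%:Z).
Proof.
apply/mapP/idP => [[k]|h]; first by rewrite mem_iota => ? ->; lia.
by exists `|(i + B%:Z)%R|%N; rewrite ?mem_iota; lia.
Qed.

Definition cylinder (F : seq int) z : set configS :=
  [set z' : config | forall i, i \in F -> z' i = z i].

Lemma measurable_coordinate (i : int) (b : bool) :
  measurable ([set z : config | z i = b] : set configS).
Proof.
have m1 : measurable ([set z : config | z i] : set configS).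
  by apply: sub_sigma_algebra; exists i.
case: b; first exact: m1.
rewrite (_ : [set z | z i = false] = ~` [set z | z i]); first exact: measurableC.
by apply/seteqP; split => z /=; case: (z i).
Qed.

Lemma measurable_cylinder F z : measurable (cylinder F z).
Proof.
rewrite (_ : cylinder F z = \bigcap_(i in [set` F]) [set z' | z' i = z i]).
  apply: fin_bigcap_measurable => [|i _]; first exact: finite_seq.
  exact: measurable_coordinate.
by apply/seteqP; split => z' /= h i; apply: h.
Qed.

Lemma bigcap_cylinder z : \bigcap_B cylinder (window B) z = [set z].
Proof.
apply/seteqP; split => [z' h|_ -> B _]//.
apply/funext => i; apply: (h `|i|%N) => //; rewrite mem_window; lia.
Qed.

Lemma measurable_set1_configS z : measurable ([set z] : set configS).
Proof.
by rewrite -bigcap_cylinder; apply: bigcapT_measurable => B; exact: measurable_cylinder.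
Qed.

Lemma measurable_sub_Omega (A : set configS) : A `<=` Omega -> measurable A.
Proof.
move=> AO; apply: countable_measurable => [z|]; first exact: measurable_set1_configS.
exact: sub_countable (subset_card_le AO) countable_Omega.
Qed.

Section ProductMeasure.
Variables (R : realType) (q c : R) (mu : probability configS R).
Hypotheses (hq : 0 < q < 1) (hmu : is_product_measure q c mu).

Let q0 : 0 < q. Proof. by case/andP: hq. Qed.

Definition weight (i : int) : R := q `^ (c - i%:~R).

Lemma weight_gt0 i : 0 < weight i.
Proof. exact: powR_gt0. Qed.

Lemma weightE i : weight i = q `^ c * q ^ (- i).
Proof.
rewrite /weight powRD; last by rewrite (gt_eqF q0) implybT.
by rewrite -mulrNz powR_intmul// ltW.
Qed.

Lemma weightD i j : weight (i + j) = weight i * q ^ (- j).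
Proof. by rewrite !weightE opprD expfzDr ?mulrA// gt_eqF. Qed.

(** [is_product_measure] prescribes finite-dimensional marginals; point masses are reached from them
    as decreasing limits. *)
Lemma cvg_cylinder z : mu (cylinder (window B) z) @[B --> \oo] --> mu [set z].
Proof.
rewrite -bigcap_cylinder; apply: nonincreasing_cvg_mu.
- by rewrite (le_lt_trans (probability_le1 _ _)) ?ltry//; exact: measurable_cylinder.
- by move=> B; exact: measurable_cylinder.
- by rewrite bigcap_cylinder; exact: measurable_set1_configS.
move=> B C BC; apply/subsetPset => z' h i iB; apply: h.
by move: iB; rewrite !mem_window; lia.
Qed.

(** The cylinder probabilities differ only in the factor of site [i], and [density] over
    [1 - density] is [weight i]. This ratio passes to the limit. *)
Lemma mu_addp1 i z : ~~ z i -> (mu [set addp i z] = (weight i)%:E * mu [set z])%E.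
Proof.
move=> zi; have := @cvg_cylinder (addp i z).
suff h : (mu (cylinder (window B) (addp i z)) @[B --> \oo] -->
    (weight i)%:E * mu [set z])%E by move=> h'; exact: (cvg_unique _ h' h).
apply: (@cvg_trans _ (((weight i)%:E * mu (cylinder (window B) z))%E @[B --> \oo])).
  apply: near_eq_cvg; exists `|i|%N => // B /= iB.
  rewrite !hmu ?window_uniq// -EFinM; congr EFin.
  have iw : i \in window B by rewrite mem_window; lia.
  rewrite !(bigD1_seq i iw (window_uniq B))/= mulrA; congr (_ * _); last first.
    by apply: eq_bigr => j /negPf ji; rewrite /addp ji.
  rewrite /addp eqxx/= (negPf zi) /density -/(weight i).
  by have w0 := weight_gt0 i; field; rewrite gt_eqF// addr_gt0.
apply: cvgeMl => //; exact: cvg_cylinder.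
Qed.

Definition pr (A : set configS) : R := fine (mu A).

Lemma prE A : A `<=` Omega -> mu A = (pr A)%:E.
Proof.
move=> AO; rewrite /pr fineK// fin_num_measure//; exact: measurable_sub_Omega.
Qed.

Lemma pr_ge0 A : 0 <= pr A.
Proof. exact: fine_ge0. Qed.

Lemma mu_esum (A : set configS) : A `<=` Omega ->
  (mu A = \esum_(z in A) (pr [set z])%:E)%E.
Proof.
move=> AO; have cA : countable A := sub_countable (subset_card_le AO) countable_Omega.
have := @measure_preimage_esum _ configS R mu config id A cA; rewrite /= => ->.
  apply: eq_esum => z Az; rewrite -prE//; last by move=> _ ->; exact: AO.
by move=> z _; exact: measurable_set1_configS.
Qed.

Lemma pr_setU (A B : set configS) : A `<=` Omega -> B `<=` Omega ->
  A `&` B = set0 -> pr (A `|` B) = pr A + pr B.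
Proof.
move=> AO BO AB; rewrite /pr measureU// ?fineD// ?fin_num_measure//;
  exact: measurable_sub_Omega.
Qed.

Lemma pr_addp i (A : set configS) : A `<=` Omega -> (forall z, A z -> ~~ z i) ->
  pr (addp i @` A) = weight i * pr A.
Proof.
move=> AO Ai.
have iAO : addp i @` A `<=` Omega by move=> _ [z /AO Oz <-]; exact/Omega_addp.
apply: EFin_inj; rewrite EFinM -!prE// !mu_esum// esum_image; last first.
  move=> z z'; rewrite !inE => /Ai zi /Ai zi' e.
  by rewrite -(addpK zi) -(addpK zi') e.
rewrite -ge0_esumZl.
- apply: eq_esum => z Az; rewrite -EFinM; congr EFin.
  rewrite /pr mu_addp1 ?Ai// fineM// fin_num_measure//.
  exact: measurable_set1_configS.
- by move=> z _; rewrite lee_fin pr_ge0.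
- by rewrite ltW ?weight_gt0.
Qed.

Lemma pr_addp1 i z : Omega z -> ~~ z i -> pr [set addp i z] = weight i * pr [set z].
Proof.
move=> Oz zi; rewrite -pr_addp ?image_set1//; by move=> _ ->.
Qed.

Lemma cvg_pr_bigcup (F : nat -> set configS) : (forall k, F k `<=` Omega) ->
  (forall k l, (k <= l)%N -> F k `<=` F l) ->
  pr (F k) @[k --> \oo] --> pr (\bigcup_k F k).
Proof.
move=> FO Fh; have UO : \bigcup_k F k `<=` Omega by move=> z [k _ /FO].
apply: (@fine_cvg _ _ _ _ (mu \o F)); rewrite -prE//.
apply: nondecreasing_cvg_mu => //.
- by move=> k; exact: measurable_sub_Omega.
- exact: measurable_sub_Omega.
- by move=> k l kl; apply/subsetPset; exact: Fh.
Qed.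

End ProductMeasure.

(** * Limits of q-binomial coefficients *)

Section QBinomial.
Variables (R : realType) (q : R).
Hypothesis hq : 0 < q < 1.

Let q0 : 0 < q. Proof. by case/andP: hq. Qed.
Let q1 : q < 1. Proof. by case/andP: hq. Qed.
Let qN0 : q != 0. Proof. by rewrite gt_eqF. Qed.

Lemma onemX_gt0 k : 0 < 1 - q ^+ k.+1.
Proof. by rewrite subr_gt0 exprn_ilt1// ltW. Qed.

Let onemXN0 k : 1 - q ^+ k.+1 != 0. Proof. by rewrite gt_eqF ?onemX_gt0. Qed.

Lemma qpochS r : qpoch q r.+1 = qpoch q r * (1 - q ^+ r.+1).
Proof. by rewrite /qpoch big_nat_recr. Qed.

Lemma qpoch0 : qpoch q 0 = 1.
Proof. by rewrite /qpoch big_geq. Qed.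

Lemma qpoch_gt0 r : 0 < qpoch q r.
Proof. by elim: r => [|r IH]; rewrite ?qpoch0// qpochS mulr_gt0// onemX_gt0. Qed.

Lemma cvg_qpoch : qpoch q r @[r --> \oo] --> qpoch_oo q.
Proof.
apply: nonincreasing_is_cvgn.
  apply/nonincreasing_seqP => r; rewrite qpochS ler_piMr//; first exact/ltW/qpoch_gt0.
  by rewrite lerBlDr lerDl exprn_ge0// ltW.
by exists 0 => _ [r _ <-]; exact/ltW/qpoch_gt0.
Qed.

Lemma qbinom0 a : qbinom q a 0 = 1.
Proof. by rewrite /qbinom big_geq. Qed.

Lemma qbinomSr a (g : nat) :
  qbinom q a g.+1%:Z = qbinom q a g%:Z * ((1 - q ^ (a - g%:Z)) / (1 - q ^+ g.+1)).
Proof. by rewrite /qbinom !absz_nat big_nat_recr. Qed.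

(** Holds for every integer [a]: after multiplication by [1 - q ^+ g.+1] both sides become multiples
    of [qbinom q a g], the left one by the absorption identity [shift]. *)
Lemma qbinom_pascal a (g : nat) :
  qbinom q (a + 1) g.+1%:Z = qbinom q a g.+1%:Z + q ^ (a - g%:Z) * qbinom q a g%:Z.
Proof.
have shift : qbinom q (a + 1) g.+1%:Z * (1 - q ^+ g.+1) = qbinom q a g%:Z * (1 - q ^ (a + 1)).
  elim: g => [|g IH]; first by rewrite qbinomSr !qbinom0 subr0 mul1r divfK// mul1r.
  rewrite qbinomSr mulrA divfK// [in RHS]qbinomSr.
  have -> : a + 1 - g.+1%:Z = a - g%:Z by lia.
  move: IH; set x := qbinom q (a + 1) _; set y := qbinom q a g%:Z => IH.
  rewrite -(mulrA y) (mulrC _ (1 - q ^ (a + 1))) mulrA -IH.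
  by field; exact: onemXN0.
apply: (mulIf (onemXN0 g)); rewrite shift qbinomSr.
have -> : q ^ (a + 1) = q ^ (a - g%:Z) * q ^+ g.+1.
  by rewrite exprnP -expfzDr//; congr (_ ^ _); lia.
by field; exact: onemXN0.
Qed.

Lemma qbinom_small (L g : nat) : (L < g)%N -> qbinom q L%:Z g%:Z = 0.
Proof.
move=> Lg; rewrite /qbinom absz_nat big_mkord (bigD1 (Ordinal Lg))//=.
by rewrite subrr expr0z subrr mul0r mul0r.
Qed.

Lemma qbinom_qpoch (L g : nat) : (g <= L)%N ->
  qbinom q L%:Z g%:Z * qpoch q g * qpoch q (L - g) = qpoch q L.
Proof.
elim: g => [|g IH] gL; first by rewrite qbinom0 qpoch0 !mul1r subn0.
rewrite -[RHS]IH; last exact: ltnW.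
rewrite qbinomSr qpochS.
have -> : (L - g = (L - g.+1).+1)%N by lia.
rewrite qpochS (exprnP q (L - g.+1).+1); have -> : (L - g.+1).+1%:Z = L%:Z - g%:Z by lia.
by field; exact: onemXN0.
Qed.

Lemma cvg_qbinom (g : nat) (u : nat -> nat) : u L @[L --> \oo] --> \oo ->
  qbinom q (u L)%:Z g%:Z @[L --> \oo] --> (qpoch q g)^-1.
Proof.
move=> uoo; elim: g => [|g IH].
  by rewrite qpoch0 invr1; under eq_fun do rewrite qbinom0; exact: cvg_cst.
under eq_fun do rewrite qbinomSr.
rewrite qpochS invfM; apply: cvgM => //.
rewrite -[X in _ --> X]mul1r; apply: cvgM; last exact: cvg_cst.
rewrite -[X in _ --> X]subr0; apply: cvgB; first exact: cvg_cst.
have -> : (fun L => q ^ ((u L)%:Z - g%:Z)) = (fun L => q ^+ u L * q ^- g).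
  by apply/funext => L; rewrite expfzDr// exprnN.
rewrite -[X in _ --> X](mul0r (q ^- g)); apply: cvgM; last exact: cvg_cst.
apply: (cvg_comp _ _ uoo); apply: cvg_expr.
by rewrite gtr0_norm.
Qed.

(** By symmetry of the q-binomial this is [cvg_qbinom] at [r]. It serves the window right of the
    last prescribed particle, where the number of holes, not of particles, stays fixed. *)
Lemma cvg_qbinom_codiff (r : nat) (u : nat -> nat) : u L @[L --> \oo] --> \oo ->
  qbinom q (u L)%:Z ((u L)%:Z - r%:Z) @[L --> \oo] --> (qpoch q r)^-1.
Proof.
move=> uoo; apply: cvg_trans (cvg_qbinom uoo (g := r)).
apply: near_eq_cvg; near=> L.
have rL : (r <= u L)%N by near: L; exact: (cvgnyPge _).1 uoo r.
have -> : (u L)%:Z - r%:Z = (u L - r)%N%:Z by lia.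
have h1 := qbinom_qpoch rL; have := @qbinom_qpoch (u L) (u L - r) (leq_subr _ _).
have -> : (u L - (u L - r) = r)%N by lia.
rewrite -h1 -!mulrA (mulrC (qpoch q (_ - _))) => /mulIf e; apply/esym/e.
by rewrite mulf_neq0// gt_eqF// qpoch_gt0.
Unshelve. all: by end_near.
Qed.

End QBinomial.

(** * Configurations with particles at prescribed sites and labels *)

Definition clr (e : int) z : config := fun i => (e <= i) && z i.

Lemma clr_id e z : (forall i, i < e -> ~~ z i) -> clr e z = z.
Proof.
move=> h; apply/funext => i; rewrite /clr.
by have [//|/h/negPf ->] := leP e i.
Qed.

Lemma clrD1 e z : clr (e + 1) z = remp e (clr e z).
Proof. by apply/funext => i; rewrite /clr /remp; case: (z i); lia. Qed.

Lemma Omega_clr e z : Omega z -> Omega (clr e z).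
Proof.
move=> Oz; have [B B0 [zl zr]] := Omega_bounds Oz.
apply: (@Omega_eq_off z _ [set i | - B <= i <= e]) Oz; first exact: finite_itv_int.
move=> i /= h; rewrite /clr; have [//|ie] := leP e i.
have [iB|] := ltP i (- B) => /=; first exact: negbTE (zl i iB).
by move=> Bi; case: h; rewrite Bi ltW.
Qed.

Lemma remp_id i z : ~~ z i -> remp i z = z.
Proof.
move=> /negPf zi; apply/funext => l; rewrite /remp.
by have [->|] := eqVneq l i.
Qed.

(** Each erased particle raises [N] by one, and [label z e] counts the erased ones. *)
Lemma N_clr e z : Omega z -> N (clr e z) = N z + label z e.
Proof.
move=> Oz; have [B B0 [zl _]] := Omega_bounds Oz.
have base i : i <= - B -> N (clr i z) = N z + label z i.
  move=> iB; rewrite clr_id ?label_eq0 ?addr0// => l li; apply: zl; lia.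
have [eB|/ltW Be] := leP e (- B); first exact: base.
move: e Be; apply: int_lt_ind; first exact: base.
move=> i Bi IH; rewrite labelS// addrA -IH clrD1.
have ci : clr i z i = z i by rewrite /clr lexx.
case zi : (z i); first by rewrite N_remp ?ci//; exact: Omega_clr.
by rewrite remp_id ?addr0// ci zi.
Qed.

Lemma label_clr e p z : Omega z -> e <= p -> label (clr e z) p = label z p - label z e.
Proof.
move=> Oz; move: p; apply: int_lt_ind => [|p ep IH].
  by rewrite subrr label_eq0// => i ie; rewrite /clr leNgt ie.
by rewrite !labelS//; [rewrite IH /clr ep addrAC|exact: Omega_clr].
Qed.

(** As nothing lies left of [s], [label z e] is the number of particles in the window from [s] to
    [e - 1]. *)
Definition block (s e : int) (g : nat) (A : set configS) : set configS :=
  [set z : config | [/\ Omega z, forall i, i < s -> ~~ z i, label z e = g%:Z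
    & A (clr e z)]].

Lemma block_self e A : A `<=` Omega -> (forall z, A z -> forall i, i < e -> ~~ z i) ->
  block e e 0 A = A.
Proof.
move=> AO Ae; apply/seteqP; split => [z [Oz ze _]|z Az]; first by rewrite clr_id.
have ze := Ae z Az; split => //; [exact: AO|exact: label_eq0|by rewrite clr_id].
Qed.

Lemma block_self0 e g A : block e e g.+1 A = set0.
Proof. by apply/seteqP; split => // z [_ ze]; rewrite label_eq0. Qed.

(** Whether [s] is empty or occupied: the two pieces will be the two terms of the q-Pascal rule. *)
Lemma block_split s e g A : s < e ->
  block s e g.+1 A = block (s + 1) e g.+1 A `|` addp s @` block (s + 1) e g A.
Proof.
move=> se; apply/seteqP; split => z.
  move=> [Oz zs lz Az]; case zs0 : (z s); last first.
    left; split => // i iS; have [->|i1] := eqVneq i s; first by rewrite zs0.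
    by apply: zs; lia.
  right; exists (remp s z); last exact: rempK.
  have rs : ~~ remp s z s by rewrite /remp eqxx.
  have Or : Omega (remp s z) by apply/Omega_remp.
  split => //.
  - move=> i iS; rewrite /remp; have [//|i1 /=] := eqVneq i s.
    by apply: zs; lia.
  - by have := @label_addp _ _ e Or rs; rewrite rempK// lz se; lia.
  - rewrite (_ : clr e _ = clr e z)//; apply/funext => i; rewrite /clr /remp.
    by have [ei|//] := leP e i; have -> : i != s by lia.
case=> [[Oz zs lz Az]|[y [Oy ys ly Ay] <-]].
  by split => // i iS; apply: zs; lia.
have yS : ~~ y s by apply: ys; rewrite ltrDl.
split.
- exact/Omega_addp.
- move=> i iS; rewrite /addp negb_or ys ?andbT; lia.
- by rewrite label_addp// ly se; lia.
- rewrite (_ : clr e _ = clr e y)//; apply/funext => i; rewrite /clr /addp.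
  by have [ei|//] := leP e i; have -> : (i == s) = false by lia.
Qed.

Lemma block_split0 s e A : s < e -> block s e 0 A = block (s + 1) e 0 A.
Proof.
move=> se; apply/seteqP; split => z [Oz zs lz Az]; split => // i iS.
  have [->|i1] := eqVneq i s; last by apply: zs; lia.
  by apply/negP => /(label_lt Oz)/(_ se); rewrite lz; have := label_ge0 z s; lia.
by apply: zs; lia.
Qed.

Section BlockWeight.
Variables (R : realType) (q c : R) (mu : probability configS R).
Hypotheses (hq : 0 < q < 1) (hmu : is_product_measure q c mu).

Let q0 : 0 < q. Proof. by case/andP: hq. Qed.
Let qN0 : q != 0. Proof. by rewrite gt_eqF. Qed.

(* The product of the weights of the sites e-1, ..., e-g. *)
Definition block_weight (g : nat) (e : int) : R :=
  (q `^ c) ^+ g * q ^ ('C(g.+1, 2)%:Z - g%:Z * e).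

Lemma block_weight0 e : block_weight 0 e = 1.
Proof. by rewrite /block_weight expr0 mul1r bin_small// mul0r subr0. Qed.

Lemma block_weightS g e :
  block_weight g.+1 e = weight q c (e - g.+1%:Z) * block_weight g e.
Proof.
rewrite /block_weight weightE// exprS [RHS]mulrACA -expfzDr//; congr (_ * _ ^ _).
by rewrite binS bin1; lia.
Qed.

Lemma block_weight_gt0 g e : 0 < block_weight g e.
Proof. by rewrite mulr_gt0 ?exprn_gt0 ?powR_gt0 ?exprz_gt0. Qed.

(** Packed against [e], the [g] particles have weight [block_weight g e]; every step to the left
    costs a factor [q], and the q-binomial is the generating function of the total displacement. The
    induction adds sites on the left of the window. *)
Lemma pr_block (A : set configS) (e : int) : A `<=` Omega ->
  (forall z, A z -> forall i, i < e -> ~~ z i) ->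
  forall (L g : nat), pr mu (block (e - L%:Z) e g A) =
    block_weight g e * qbinom q L%:Z g%:Z * pr mu A.
Proof.
move=> AO Ae; have bO s g : block s e g A `<=` Omega by move=> z [].
elim=> [|L IH] g.
  rewrite subr0; case: g => [|g].
    by rewrite block_self// qbinom0 block_weight0 !mul1r.
  by rewrite block_self0 /pr measure0 qbinom_small// mulr0 mul0r.
have eL : e - L.+1%:Z < e by lia.
have eL1 : e - L.+1%:Z + 1 = e - L%:Z by lia.
case: g => [|g]; first by rewrite block_split0// eL1 IH !qbinom0.
rewrite block_split// eL1 pr_setU//; last 2 first.
- by move=> _ [y /bO Oy <-]; exact/Omega_addp.
- apply/seteqP; split => // z [[_ h _ _] [y _ yz]].
  have := h (e - L.+1%:Z); rewrite -yz /addp eqxx /= => /(_ _)/negP; apply => //.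
  by lia.
rewrite (pr_addp hq hmu)//; last first.
  by move=> z [_ h _ _]; apply: h; lia.
rewrite !IH block_weightS.
have -> : L.+1%:Z = L%:Z + 1 by lia.
rewrite qbinom_pascal//.
(* The new site lies [L - g] steps left of site [e - g.+1], whence the factor [q ^ (L - g)] of the
   q-Pascal rule. *)
have -> : e - (L%:Z + 1) = e - g.+1%:Z + (g%:Z - L%:Z) by lia.
rewrite (weightD c hq (e - g.+1%:Z)) opprB; ring.
Qed.

(** [gs n] arises from [gs (n + g)] by filling the sites [n + 1] to [n + g]. This exchanges powers
    of q^c for a change of ground state. *)
Lemma pr_gsD n g :
  block_weight g (n + g%:Z + 1) * pr mu [set gs (n + g%:Z)] = pr mu [set gs n].
Proof.
elim: g => [|g IH].
  by rewrite block_weight0 mul1r addr0.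
rewrite -IH; have -> : n + g.+1%:Z = n + g%:Z + 1 by lia.
rewrite [in RHS]gs_addp (pr_addp1 hq hmu)//; last 2 first.
- exact: Omega_gs.
- by rewrite /gs ltxx.
rewrite mulrA; congr (_ * _).
rewrite /block_weight weightE// exprSr [RHS]mulrACA -expfzDr//; congr (_ * _ ^ _).
by rewrite [in LHS]binS bin1; lia.
Qed.

End BlockWeight.

(* Configurations with N = n and no particle up to the site [a], seen as what
   remains right of a particle with label [b] at [a]: [l] lists sites together
   with the labels, counted from the erased particle on, of the particles that
   must sit there. *)
Definition marked (n a b : int) (l : seq (int * int)) : set configS :=
  [set z : config | [/\ Omega z, forall i, i <= a -> ~~ z i, N z = n
    & forall p, p \in l -> z p.1 /\ label z p.1 = p.2 - b - 1]].

Lemma marked_sub_Omega n a b l : marked n a b l `<=` Omega.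
Proof. by move=> z []. Qed.

(** The window from [a + 1] to [m - 1] holds the [k - b - 1] particles with labels strictly between
    [b] and [k]; erasing these and the one at [m] raises [N] by [k - b]. *)
Lemma marked_cons (n a b m k : int) (l : seq (int * int)) :
  a < m -> b < k -> (forall p, p \in l -> m < p.1) ->
  marked n a b ((m, k) :: l) =
  block (a + 1) m `|(k - b - 1)%R|%N (addp m @` marked (n + (k - b)) m k l).
Proof.
move=> am bk ml; apply/seteqP; split => z.
  move=> [Oz za Nz zl]; have [zm lm] := zl (m, k) (mem_head _ _).
  rewrite /= in zm lm.
  have lm1 : label z (m + 1) = k - b by rewrite labelS// lm zm; lia.
  split => //; [by move=> i ia; apply: za; lia|by rewrite lm; lia|].
  exists (clr (m + 1) z); last by rewrite clrD1 rempK// /clr lexx.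
  split.
  - exact: Omega_clr.
  - by move=> i im; rewrite /clr; have -> : (m + 1 <= i) = false by lia.
  - by rewrite N_clr// Nz lm1.
  - move=> [s t] pl; have /= ms := ml _ pl; have [|/= zs ls] := zl (s, t).
      by rewrite inE pl orbT.
    by rewrite /clr zs label_clr// ?ls ?lm1; lia.
move=> [Oz za lm [y [Oy ym Ny yl] yE]].
have yclr : clr (m + 1) z = y.
  by rewrite clrD1 -yE addpK//; exact: ym.
have zm : z m.
  by have := congr1 (fun z => z m) yE; rewrite /addp /clr eqxx lexx /= => <-.
have lm1 : label z (m + 1) = k - b by rewrite labelS// lm zm; lia.
split => //; first by move=> i ia; apply: za; lia.
  by have := N_clr (m + 1) Oz; rewrite yclr Ny lm1; lia.
move=> p; rewrite inE => /orP[/eqP->/=|pl].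
  by split => //; rewrite lm; lia.
case: p pl => s t pl /=; have /= ms := ml _ pl; have [/= ys ls] := yl _ pl; split.
  by move: ys; rewrite -yclr => /andP[].
by move: ls; rewrite -yclr label_clr// ?lm1; lia.
Qed.

Lemma marked_nil n a b b' : marked n a b [::] = marked n a b' [::].
Proof. by apply/seteqP; split => z [Oz za Nz _]. Qed.

Definition pinned (n : int) (l : seq (int * int)) : set configS :=
  [set z : config | [/\ Omega z, N z = n
    & forall p, p \in l -> z p.1 /\ label z p.1 = p.2]].

(** The reference label -1 turns the relative labels into absolute ones, and each configuration of
    [Omega] is empty far to the left. *)
Lemma pinnedE n l : pinned n l = \bigcup_(B : nat) marked n (- B%:Z) (-1) l.
Proof.
apply/seteqP; split => z.
  move=> [Oz Nz zl]; have [B B0 [zB _]] := Omega_bounds Oz.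
  exists `|(B + 1)%R|%N => //; split => // [i iB|p /zl[-> ->]]; first by apply: zB; lia.
  by split => //; lia.
move=> [B _ [Oz _ Nz zl]]; split => // p /zl[-> ->]; split => //; lia.
Qed.

Lemma cvg_pinned (R : realType) (mu : probability configS R) n l :
  pr mu (marked n (- B%:Z) (-1) l) @[B --> \oo] -->
  pr mu (pinned n l).
Proof.
rewrite pinnedE; apply: cvg_pr_bigcup => [B|k j kj z [Oz zk Nz zl]].
  exact: marked_sub_Omega.
by split => // i ij; apply: zk; lia.
Qed.

Section MarkedWeight.
Variables (R : realType) (q c : R) (mu : probability configS R).
Hypotheses (hq : 0 < q < 1) (hmu : is_product_measure q c mu).

Let q0 : 0 < q. Proof. by case/andP: hq. Qed.

Lemma pr_marked_cons (n a b m k : int) (l : seq (int * int)) : a < m -> b < k ->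
  (forall p, p \in l -> m < p.1) ->
  pr mu (marked n a b ((m, k) :: l)) =
  block_weight q c `|(k - b - 1)%R|%N m * qbinom q (m - a - 1) (k - b - 1)
   * weight q c m * pr mu (marked (n + (k - b)) m k l).
Proof.
move=> am bk ml; rewrite marked_cons//.
have -> : a + 1 = m - `|(m - a - 1)%R|%N%:Z by lia.
rewrite (pr_block hq hmu); last 2 first.
- by move=> _ [y [Oy _ _ _] <-]; exact/Omega_addp.
- move=> _ [y [_ ym _ _] <-] i im; rewrite /addp negb_or ym ?andbT; lia.
rewrite (pr_addp hq hmu); last 2 first.
- exact: marked_sub_Omega.
- by move=> y [_ ym _ _]; exact: ym.
rewrite mulrA; congr (_ * qbinom q _ _ * _ * _); lia.
Qed.

(** If all sites from [e j] on are full, [N = n] means that the window from [a + 1] to [e j - 1] has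
    [n - a] holes, and [pr_block] applies; then [j] tends to infinity. *)
Lemma pr_marked_nil n a b : pr mu (marked n a b [::]) =
  if a <= n then pr mu [set gs n] / qpoch q `|(n - a)%R|%N else 0.
Proof.
(* Starting at this length keeps the number of particles in the window nonnegative for all [j]. *)
pose L0 := `|(n - a)%R|%N.
pose e (j : nat) : int := a + 1 + (L0 + j)%N%:Z.
pose F j : set configS := [set z | marked n a b [::] z /\ forall i : int, e j <= i -> z i].
have FO j : F j `<=` Omega by move=> z [[]].
have Fbig : marked n a b [::] = \bigcup_j F j.
  apply/seteqP; split => [z mz|z [j _ []//]].
  have [B B0 [_ zB]] := Omega_bounds (marked_sub_Omega mz).
  by exists `|(B - a)%R|%N => //; split => // i ei; apply: zB; move: ei; rewrite /e; lia.
have Fmono k l : (k <= l)%N -> F k `<=` F l.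
  by move=> kl z [mz h]; split => // i ei; apply: h; move: ei; rewrite /e; lia.
have := cvg_pr_bigcup (mu := mu) FO Fmono; rewrite -Fbig => cvF.
have FE j : pr mu (F j) =
    pr mu [set gs n] * qbinom q (L0 + j)%N%:Z ((L0 + j)%N%:Z - (n - a)).
  pose g := `|((L0 + j)%N%:Z - (n - a))%R|%N.
  have gE : g%:Z = (L0 + j)%N%:Z - (n - a) by rewrite /g /L0; lia.
  have -> : F j = block (e j - (L0 + j)%N%:Z) (e j) g [set gs (n + g%:Z)].
    have eg : n + g%:Z = e j - 1 by rewrite gE /e; lia.
    rewrite eg; have -> : e j - (L0 + j)%N%:Z = a + 1 by rewrite /e; lia.
    apply/seteqP; split => z.
      move=> [[Oz za Nz _] zr].
      have zc : clr (e j) z = gs (e j - 1).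
        apply/funext => i; rewrite /clr /gs.
        by have [ei|] := leP (e j) i; [rewrite (zr i ei)|]; lia.
      split => //; first by move=> i ia; apply: za; lia.
      by have := N_clr (e j) Oz; rewrite zc N_gs Nz gE /e; lia.
    move=> [Oz za lz zc]; rewrite /= in zc; split; first split => //.
    - by move=> i ia; apply: za; lia.
    - by have := N_clr (e j) Oz; rewrite zc N_gs lz; lia.
    move=> i ei; have := congr1 (fun z => z i) zc; rewrite /clr /gs ei /= => ->; lia.
  rewrite (pr_block hq hmu); last 2 first.
  - by move=> _ ->; exact: Omega_gs.
  - by move=> _ -> i; rewrite /gs gE /e; lia.
  rewrite -(pr_gsD hq hmu n g) gE mulrAC; congr (block_weight _ _ _ _ * _ * _).
  by rewrite /e; lia.
move: cvF; under eq_fun do rewrite FE.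
case: leP => an cvF.
  apply: (cvg_unique _ cvF) => //; apply: cvgM; first exact: cvg_cst.
  have := @cvg_qbinom_codiff R q hq `|(n - a)%R|%N (addn L0) (cvg_addnl L0).
  by have <- : n - a = `|(n - a)%R|%N%:Z by lia.
(* For [n < a] the window would have to hold more particles than it has sites. *)
apply: (cvg_unique _ cvF) => //.
rewrite (_ : (fun _ => _) = cst 0); first exact: cvg_cst.
apply/funext => j.
have -> : (L0 + j)%N%:Z - (n - a) = (L0 + j + `|(n - a)%R|)%N%:Z by lia.
by rewrite qbinom_small ?mulr0//; lia.
Qed.

(** The limit of [pr_marked_nil] as the empty half-line recedes to the left. Relative to mu{[gs n]},
    the set {N = n} thus has the mass 1 / (q;q)_oo of the partition generating function. *)
Lemma pr_pinned_nil n : pr mu (pinned n [::]) * qpoch_oo q = pr mu [set gs n].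
Proof.
pose u (B : nat) := pr mu (marked n (- B%:Z) (-1) [::]) * qpoch q `|(n - - B%:Z)%R|%N.
have h1 : u B @[B --> \oo] --> pr mu (pinned n [::]) * qpoch_oo q.
  apply: cvgM; first exact: cvg_pinned.
  apply: cvg_comp (cvg_qpoch hq) => A [M _ MA]; exists (M + `|n|)%N => // B /= h.
  by apply: MA => /=; lia.
apply: (cvg_unique _ h1) => //.
apply: (@cvg_trans _ (cst (pr mu [set gs n]) @ \oo)); last exact: cvg_cst.
apply: near_eq_cvg; exists `|n|%N => // B /= h.
rewrite /u pr_marked_nil; have -> : - B%:Z <= n by lia.
by rewrite divfK// gt_eqF// qpoch_gt0.
Qed.

(** Left of [m] the window grows while its number [k] of particles stays fixed, so its q-binomial
    tends to 1 / (q;q)_k. *)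
Lemma pr_pinned_cons (n m : int) (k : nat) (l : seq (int * int)) : (forall p, p \in l -> m < p.1) ->
  pr mu (pinned n ((m, k%:Z) :: l)) =
  block_weight q c k m / qpoch q k * weight q c m * pr mu (marked (n + k%:Z + 1) m k l).
Proof.
move=> ml; apply: (cvg_unique _ (@cvg_pinned R mu n ((m, k%:Z) :: l))) => //.
apply: (@cvg_trans _ ((fun B : nat => block_weight q c k m *
   qbinom q `|(m + B%:Z - 1)%R|%N k%:Z * weight q c m *
   pr mu (marked (n + k%:Z + 1) m k l)) @ \oo)).
  apply: near_eq_cvg; exists (`|m|.+1) => // B /= h.
  rewrite pr_marked_cons//; last by lia.
  congr (block_weight _ _ _ _ * qbinom _ _ _ * _ * pr _ (marked _ _ _ _)); lia.
apply: cvgMr_tmp; apply: cvgMr_tmp; apply: cvgMl_tmp.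
apply: (cvg_qbinom hq) => A [M _ MA]; exists (M + `|m| + 1)%N => // B /= h.
by apply: MA => /=; lia.
Qed.

End MarkedWeight.

(** * The coupled system *)

Lemma esum_geometric (R : realType) (a r : R) : 0 <= a -> 0 <= r < 1 ->
  (\esum_(i in [set: nat]) (a * r ^+ i)%:E = (a / (1 - r))%:E)%E.
Proof.
move=> a0 /andP[r0 r1]; have ar0 i : 0 <= a * r ^+ i.
  by rewrite mulr_ge0// exprn_ge0.
rewrite -nneseries_esumT//; apply/cvg_lim => //; apply: cvg_EFin.
  by apply: nearW => k; rewrite sumEFin.
rewrite (_ : _ \o _ = series (geometric a r)).
  by apply: cvg_geometric_series; rewrite ger0_norm.
by apply/funext => k; rewrite /series /= sumEFin.
Qed.

(** The sentinel -1 merges nonnegativity into the ordering condition. *)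
Lemma Zplus_path d (x : d.-tuple int) : Zplus d x <-> path <%R (-1) x.
Proof.
rewrite /Zplus/=; case: (tval x) => [|k s] /=; first by split.
split=> [[ps /andP[k0 _]]|/andP[k0 ps]]; first by rewrite ps andbT; lia.
split => //; apply/andP; split; first by lia.
have := order_path_min lt_trans ps; apply: sub_all => i /=; lia.
Qed.

(** * Total weight of the labels *)

Section LabelSum.
Variables (R : realType) (q : R).
Hypothesis hq : 0 < q < 1.

Let q0 : 0 < q. Proof. by case/andP: hq. Qed.
Let q1 : q < 1. Proof. by case/andP: hq. Qed.
Let qN0 : q != 0. Proof. by rewrite gt_eqF. Qed.

Definition label_weight d (x : d.-tuple int) : R := q ^ (\sum_(i <- x) i).

Lemma label_weight_gt0 d (x : d.-tuple int) : 0 < label_weight x.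
Proof. exact: exprz_gt0. Qed.

(** The lower bound [b] is general because, once the first label is fixed, it bounds the remaining
    ones. Summing over the first label is then a geometric series of ratio [q ^+ d.+1]. *)
Lemma esum_label_weight_path d (b : int) :
  (\esum_(x in [set x : d.-tuple int | path <%R b x]) (label_weight x)%:E =
  (q ^ (d%:Z * (b + 1) + 'C(d, 2)%:Z) / qpoch q d)%:E)%E.
Proof.
elim: d b => [|d IH] b.
  rewrite (_ : [set x : 0.-tuple int | _] = [set [tuple]]).
    rewrite esum_set1 ?lee_fin ?ltW ?label_weight_gt0//.
    by rewrite /label_weight /= big_nil mul0r qpoch0 invr1 mulr1.
  by apply/seteqP; split => x /=; rewrite tuple0.
pose e (p : int * d.-tuple int) : d.+1.-tuple int := [tuple of p.1 :: p.2].
rewrite (@reindex_esum _ _ _ ([set k : int | b < k] `*``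
    (fun k => [set x : d.-tuple int | path <%R k x])) _ e); last first.
  split.
  - by move=> [k x] [/= bk kx]; rewrite bk.
  - move=> [k x] [k' x'] _ _ /(congr1 val) /= [-> xx]; congr (_, _).
    exact: val_inj.
  - move=> x /=; case/tupleP: x => k x /= /andP[bk kx].
    by exists (k, x) => //; exact: val_inj.
rewrite -(@esum_esum _ _ _ _ _ (fun k x => (label_weight (e (k, x)))%:E)); last first.
  by move=> i j _ _; rewrite lee_fin ltW// label_weight_gt0.
pose f (i : nat) : int := b + 1 + i%:Z.
rewrite (@reindex_esum _ _ _ [set: nat] _ f); last first.
  split.
  - by move=> i _; rewrite /f /=; lia.
  - by move=> i j _ _; rewrite /f; lia.
  - by move=> k /= bk; exists `|(k - b - 1)%R|%N => //; rewrite /f; lia.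
have qp0 := qpoch_gt0 hq.
transitivity (\esum_(i in [set: nat]) (q ^ (d.+1%:Z * (b + 1) + 'C(d.+1, 2)%:Z) /
   qpoch q d * (q ^+ d.+1) ^+ i)%:E)%E.
  apply: eq_esum => i _.
  have -> : (\esum_(x in [set x : d.-tuple int | path <%R (f i) x])
      (label_weight (e (f i, x)))%:E = (q ^ f i)%:E *
      \esum_(x in [set x : d.-tuple int | path <%R (f i) x]) (label_weight x)%:E)%E.
    rewrite -ge0_esumZl ?ltW ?exprz_gt0//; last first.
      by move=> x _; rewrite lee_fin ltW// label_weight_gt0.
    apply: eq_esum => x _; rewrite -EFinM /label_weight /= big_cons.
    by rewrite expfzDr.
  rewrite IH -EFinM; congr EFin; rewrite mulrA [RHS]mulrAC; congr (_ / _).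
  rewrite -exprM exprnP -!expfzDr//; congr (_ ^ _).
  by rewrite /f [in RHS]binS bin1; lia.
rewrite esum_geometric; last 2 first.
- by rewrite divr_ge0// ltW ?exprz_gt0.
- by rewrite exprn_ge0 ?ltW//= exprn_ilt1// ltW.
by rewrite qpochS invfM mulrA.
Qed.

Lemma esum_label_weight d : (\esum_(x in Zplus d) (label_weight x)%:E =
  (q ^+ 'C(d, 2) / qpoch q d)%:E)%E.
Proof.
have -> : Zplus d = [set x : d.-tuple int | path <%R (-1) x].
  by apply/seteqP; split => x /Zplus_path.
by rewrite esum_label_weight_path addNr mulr0 add0r exprnP.
Qed.

End LabelSum.

(** * Reversibility of the jump rates *)

Lemma swap_left i z : swap i z i = z (i + 1).
Proof. by rewrite /swap eqxx. Qed.

Lemma swap_right i z : swap i z (i + 1) = z i.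
Proof. by rewrite /swap eqxx; have -> : (i + 1 == i) = false by lia. Qed.

Lemma swapK i : involutive (swap i).
Proof.
move=> z; apply/funext => l; rewrite {1}/swap swap_left swap_right.
have [->//|li] := eqVneq l i; have [->//|li1] := eqVneq l (i + 1).
by rewrite /swap (negPf li) (negPf li1).
Qed.

Lemma swapE i z : z i -> ~~ z (i + 1) -> swap i z = addp (i + 1) (remp i z).
Proof.
move=> zi zi1; apply/funext => l; rewrite /swap /addp /remp.
have [->|li] := eqVneq l i; first by rewrite (negPf zi1); lia.
by have [->|li1] //= := eqVneq l (i + 1).
Qed.

Lemma swap_neq i z : z i != z (i + 1) -> swap i z != z.
Proof. by move=> h; apply: contra h => /eqP e; rewrite -{2}e swap_right. Qed.

Lemma Omega_swap i z : Omega z -> Omega (swap i z).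
Proof.
apply: (@Omega_eq_off _ _ [set l | i <= l <= i + 1]); first exact: finite_itv_int.
move=> l /= h; rewrite /swap.
by have [e|] := eqVneq l i; [|have [e|//] := eqVneq l (i + 1)]; case: h; lia.
Qed.

Lemma finite_interfaces z : Omega z -> finite_set [set i | z i != z (i + 1)].
Proof.
move=> /Omega_bounds[B B0 [zl zr]].
apply: sub_finite_set (@finite_itv_int (- B - 1) B) => i /=.
have [iB|iB] := ltP i (- B - 1).
  by rewrite (negPf (zl i _)) ?(negPf (zl (i + 1) _)) ?eqxx//; lia.
have [Bi|//] := ltP B i.
by rewrite (zr i Bi) (zr (i + 1)) ?eqxx//; lia.
Qed.

Section Rates.
Variables (R : realType) (q : R) (d : nat).
Hypothesis hq : 0 < q < 1.
Implicit Types x : d.-tuple int.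

Let q0 : 0 < q. Proof. by case/andP: hq. Qed.
Let q1 : q < 1. Proof. by case/andP: hq. Qed.
Let qN0 : q != 0. Proof. by rewrite gt_eqF. Qed.

Definition jump_rate (i : int) z : R :=
  (z i && ~~ z (i + 1))%:R + q * (~~ z i && z (i + 1))%:R.

Lemma jump_rate_ge0 i z : 0 <= jump_rate i z.
Proof. by rewrite addr_ge0 ?mulr_ge0// ltW. Qed.

Lemma jump_rate_le i z : jump_rate i z <= (z i != z (i + 1))%:R.
Proof.
rewrite /jump_rate; case: (z i) (z (i + 1)) => [] [] /=;
  by rewrite ?mulr0 ?mulr1 ?addr0 ?add0r// ltW.
Qed.

Lemma jump_rate_eq0 i z : z i = z (i + 1) -> jump_rate i z = 0.
Proof. by rewrite /jump_rate => <-; case: (z i); rewrite /= mulr0 addr0. Qed.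

Lemma asep_rateE z z' : asep_rate q z z' =
  \sum_(i \in [set: int]) jump_rate i z * (z' == swap i z)%:R.
Proof. by []. Qed.

Lemma asep_rate_ge0 z z' : 0 <= asep_rate q z z'.
Proof. by apply: fsumr_ge0 => i _; rewrite mulr_ge0// jump_rate_ge0. Qed.

Lemma asep_ratezz z : asep_rate q z z = 0.
Proof.
rewrite asep_rateE fsbig1// => i _.
have [e|ne] := eqVneq (z i) (z (i + 1)); first by rewrite jump_rate_eq0// mul0r.
by rewrite eq_sym (negPf (swap_neq ne)) mulr0.
Qed.

Lemma asep_rate_neq0 z z' : asep_rate q z z' != 0 ->
  exists2 i, z i != z (i + 1) & z' = swap i z.
Proof.
rewrite asep_rateE => h; apply: contrapT => H; move/eqP: h; apply.
apply: fsbig1 => i _.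
have [e|ne] := eqVneq (z i) (z (i + 1)); first by rewrite jump_rate_eq0// mul0r.
have [e|] := eqVneq z' (swap i z); last by rewrite mulr0.
by case: H; exists i.
Qed.

Lemma asep_rate_swap_gt0 i z : Omega z -> z i != z (i + 1) ->
  0 < asep_rate q z (swap i z).
Proof.
move=> Oz zi; rewrite asep_rateE.
rewrite (@fsum_D1 _ _ _ _ i)//; last first.
  apply: sub_finite_set (finite_interfaces Oz) => j [_ /=].
  by move=> h; apply/negP => /eqP e; apply: h; rewrite jump_rate_eq0// mul0r.
rewrite eqxx mulr1 ltr_wpDr//.
  by apply: fsumr_ge0 => j _; rewrite mulr_ge0// jump_rate_ge0.
rewrite /jump_rate; case: (z i) (z (i + 1)) zi => [] [] //= _;
  by rewrite ?mulr0 ?mulr1 ?addr0 ?add0r.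
Qed.

Definition up x (j : 'I_d) := set_coord x j (tnth x j + 1).
Definition down x (j : 'I_d) := set_coord x j (tnth x j - 1).

Definition up_ok z x (j : 'I_d) (x' : d.-tuple int) := let k := tnth x j in
  [&& k + 1 \notin x, neighbours z k (k + 1) & x' == up x j].
Definition down_ok z x (j : 'I_d) (x' : d.-tuple int) := let k := tnth x j in
  [&& 0 <= k - 1, k - 1 \notin x, neighbours z k (k - 1) & x' == down x j].

Lemma label_rateE z x x' : label_rate q z x x' =
  \sum_(j < d) (q * (up_ok z x j x')%:R + (down_ok z x j x')%:R).
Proof. by []. Qed.

Lemma label_rate_ge0 z x x' : 0 <= label_rate q z x x'.
Proof. by rewrite label_rateE sumr_ge0// => j _; rewrite addr_ge0// mulr_ge0// ltW. Qed.

Lemma tnth_set_coord x j k i : tnth (set_coord x j k) i = if i == j then k else tnth x i.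
Proof. by rewrite /set_coord tnth_mktuple. Qed.

Lemma set_coord_neq x j k : k != tnth x j -> set_coord x j k != x.
Proof.
by move=> kx; apply: contra kx => /eqP e; rewrite -{1}e tnth_set_coord eqxx.
Qed.

Lemma label_ratexx z x : label_rate q z x x = 0.
Proof.
rewrite label_rateE big1// => j _; rewrite /up_ok /down_ok /up /down.
rewrite ![x == _]eq_sym !(negPf (set_coord_neq _)) ?andbF ?mulr0 ?addr0//; lia.
Qed.

Lemma label_rate_neq0 z x x' : label_rate q z x x' != 0 ->
  exists j, x' = up x j \/ x' = down x j.
Proof.
rewrite label_rateE => h; apply: contrapT => H; move/eqP: h; apply.
apply: big1 => j _; rewrite /up_ok /down_ok.
have [e|_] := eqVneq x' (up x j); first by case: H; exists j; left.
have [e|_] := eqVneq x' (down x j); first by case: H; exists j; right.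
by rewrite !andbF mulr0 addr0.
Qed.

Lemma set_coord_weight x j k :
  label_weight q (set_coord x j k) = label_weight q x * q ^ (k - tnth x j).
Proof.
rewrite /label_weight -expfzDr//; congr (_ ^ _).
rewrite !big_tuple (bigD1 j)//= [in RHS](bigD1 j)//= tnth_set_coord eqxx.
rewrite (eq_bigr (fun i => tnth x i)); first by lia.
by move=> i /negPf ij; rewrite tnth_set_coord ij.
Qed.

Lemma neighboursC z k k' : neighbours z k k' = neighbours z k' k.
Proof. by rewrite /neighbours distrC. Qed.

Lemma Zplus_uniq x : Zplus d x -> uniq x.
Proof. by move=> [/lt_sorted_uniq]. Qed.

Lemma Zplus_ge0 x j : Zplus d x -> 0 <= tnth x j.
Proof. by move=> [_ /allP]; apply; exact: mem_tnth. Qed.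

Lemma up_down x j : down (up x j) j = x.
Proof.
apply: eq_from_tnth => i; rewrite /down /up !tnth_set_coord eqxx.
by have [->|//] := eqVneq i j; rewrite addrK.
Qed.

Lemma down_up x j : up (down x j) j = x.
Proof.
apply: eq_from_tnth => i; rewrite /down /up !tnth_set_coord eqxx.
by have [->|//] := eqVneq i j; rewrite subrK.
Qed.

Lemma notin_set_coord x j k : uniq x -> k != tnth x j -> tnth x j \notin set_coord x j k.
Proof.
move=> ux kx; apply/negP => /tnthP[i]; rewrite tnth_set_coord.
have [_|ij] := eqVneq i j; first by move=> e; rewrite e eqxx in kx.
by move=> /(tuple_uniqP x ux) ji; rewrite ji eqxx in ij.
Qed.

(** The neighbour condition is symmetric, the distinctness of labels frees the slot just left, and
    [0 <= k - 1] holds because the label returned to lies in [Zplus]. *)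
Lemma up_okC z x x' j : Zplus d x -> Zplus d x' -> up_ok z x j x' = down_ok z x' j x.
Proof.
move=> Zx Zx'; rewrite /up_ok /down_ok.
have [e|xx'] := eqVneq x' (up x j); last first.
  rewrite andbF; have -> : (x == down x' j) = false; last by rewrite !andbF.
  by apply: contraNF xx' => /eqP ->; rewrite down_up.
have xE : x = down x' j by rewrite e up_down.
have x'j : tnth x' j = tnth x j + 1 by rewrite e tnth_set_coord eqxx.
rewrite -xE eqxx !andbT x'j addrK Zplus_ge0// neighboursC -x'j.
have -> : tnth x' j \notin x.
  by rewrite xE notin_set_coord ?Zplus_uniq//; lia.
have -> // : tnth x j \notin x'.
by rewrite e notin_set_coord ?Zplus_uniq//; lia.
Qed.

(** Balance holds for each coordinate: an upward move has rate [q] and multiplies the weight by [q],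
    its reverse has rate 1. *)
Lemma label_rate_reversible z x x' : Zplus d x -> Zplus d x' ->
  label_weight q x * label_rate q z x x' = label_weight q x' * label_rate q z x' x.
Proof.
have upW y y' j : Zplus d y -> Zplus d y' -> label_weight q y * (q * (up_ok z y j y')%:R) =
    label_weight q y' * (down_ok z y' j y)%:R.
  move=> Zy Zy'; rewrite -up_okC//; have [h|] := boolP (up_ok z y j y'); last by rewrite !mulr0.
  move: h => /and3P[_ _ /eqP->].
  by rewrite set_coord_weight !mulr1 addrAC subrr add0r expr1z.
move=> Zx Zx'; rewrite !label_rateE !mulr_sumr; apply: eq_bigr => j _.
by rewrite !mulrDr upW// [in RHS]upW// addrC.
Qed.

End Rates.

(** Only an inequality, since the left sum is 0 on infinite support. *)
Lemma fsum_le_esum (R : realType) (T : choiceType) (D : set T) (F : T -> R) :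
  (forall i, 0 <= F i) -> ((\sum_(i \in D) F i)%:E <= \esum_(i in D) (F i)%:E)%E.
Proof.
move=> F0; have [fin|inf] := pselect (finite_set (D `&` F @^-1` [set~ 0])); last first.
  by rewrite fsbig_dflt// esum_ge0// => i _; rewrite lee_fin.
rewrite fsbig_supp -fsumEFin//; apply: esum_ge.
by exists (D `&` F @^-1` [set~ 0]) => //; split.
Qed.

Lemma esum_indic (R : realType) (T : choiceType) (S : set T) (t : T) (a : R) : 0 <= a ->
  (\esum_(b in S) (a * (b == t)%:R)%:E <= a%:E)%E.
Proof.
move=> a0; apply: (@le_trans _ _ (\esum_(b in [set t]) a%:E)%E); last first.
  by rewrite esum_set1// lee_fin.
rewrite [leLHS]esum_mkcond [leRHS]esum_mkcond; apply: le_esum => b _.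
have [->|bt] := eqVneq b t.
  by rewrite mulr1 [t \in [set t]]mem_set//; case: ifPn => // _; rewrite lee_fin.
rewrite mulr0 if_same; case: ifPn => // _; by rewrite lee_fin.
Qed.

Section Coupled.
Variables (R : realType) (q c : R) (mu : probability configS R) (d : nat).
Hypotheses (hq : 0 < q < 1) (hmu : is_product_measure q c mu).
Implicit Types (x : d.-tuple int) (a b : config * d.-tuple int).

Let q0 : 0 < q. Proof. by case/andP: hq. Qed.
Let q1 : q < 1. Proof. by case/andP: hq. Qed.
Let qN0 : q != 0. Proof. by rewrite gt_eqF. Qed.

(** Both configurations add one particle to [remp i z], at sites whose weights differ by the factor
    [q]. *)
Lemma pr_swap i z : Omega z -> z i -> ~~ z (i + 1) ->
  pr mu [set z] = q * pr mu [set swap i z].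
Proof.
move=> Oz zi zi1; rewrite swapE//.
have Or : Omega (remp i z) by apply/Omega_remp.
have ri : ~~ remp i z i by rewrite /remp eqxx.
have ri1 : ~~ remp i z (i + 1) by rewrite /remp (negPf zi1) andbF.
rewrite (pr_addp1 hq hmu Or ri1) -{1}(rempK zi) (pr_addp1 hq hmu Or ri).
by rewrite (weightD c hq) mulrA mulrCA divff// mulr1.
Qed.

Lemma asep_rate_reversible z z' : Omega z -> Omega z' ->
  pr mu [set z] * asep_rate q z z' = pr mu [set z'] * asep_rate q z' z.
Proof.
move=> Oz Oz'; rewrite !asep_rateE !mulr_fsumr; apply: eq_fsbigr => i _.
have swapC y y' : (y' == swap i y) = (y == swap i y').
  by apply/eqP/eqP => ->; rewrite swapK.
rewrite (swapC z' z); have [e|_] := eqVneq z' (swap i z); last by rewrite !mulr0.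
rewrite !mulr1 e /jump_rate swap_left swap_right.
case zi : (z i); case zi1 : (z (i + 1)); rewrite /= ?(mulr0, mulr1, addr0, add0r)//.
  by rewrite (@pr_swap i z) ?zi ?zi1// mulrC.
rewrite (@pr_swap i (swap i z)) ?swap_left ?swap_right ?zi ?zi1//.
  by rewrite swapK mulrC.
exact: Omega_swap.
Qed.

Definition coupled_weight a : R := pr mu [set a.1] * label_weight q a.2.

Lemma coupled_rate_ge0 a b : 0 <= coupled_rate q a b.
Proof.
by rewrite addr_ge0// mulr_ge0 ?asep_rate_ge0 ?label_rate_ge0.
Qed.

Lemma coupled_rateaa a : coupled_rate q a a = 0.
Proof. by rewrite /coupled_rate !eqxx mulr1 mul1r asep_ratezz label_ratexx ?addr0. Qed.

Lemma coupled_rate_reversible a b : coupled_space d a -> coupled_space d b ->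
  coupled_weight a * coupled_rate q a b = coupled_weight b * coupled_rate q b a.
Proof.
case: a => z x; case: b => z' x' [/= Oz Zx] [/= Oz' Zx'].
rewrite /coupled_weight /coupled_rate/= (eq_sym x') (eq_sym z') !mulrDr; congr (_ + _).
  have [->|_] := eqVneq x x'; last by rewrite !mulr0.
  by rewrite !mulr1 mulrAC asep_rate_reversible// mulrAC.
have [->|_] := eqVneq z z'; last by rewrite !mul0r !mulr0.
by rewrite !mul1r -!mulrA label_rate_reversible.
Qed.

Lemma coupled_rate_finite a : coupled_space d a ->
  finite_set [set b | coupled_space d b /\ coupled_rate q a b != 0].
Proof.
case: a => z x [/= Oz Zx].
apply: (@sub_finite_set _ _ (
    (fun i => (swap i z, x)) @` [set i | z i != z (i + 1)] `|`
   ((fun j => (z, up x j)) @` setT `|` (fun j => (z, down x j)) @` setT))).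
  move=> [z' x'] [_]; rewrite /coupled_rate/= => h.
  have [e1|/asep_rate_neq0[i zi z'E]] := eqVneq (asep_rate q z z') 0; last first.
    have [e2|ne] := eqVneq x x'; first by left; exists i; rewrite // z'E e2.
    right; move: h; rewrite (negPf ne) mulr0 add0r.
    have [<-|] := eqVneq z z'; last by rewrite mul0r eqxx.
    rewrite mul1r => /label_rate_neq0[j [->|->]]; [left|right]; by exists j.
  right; move: h; rewrite e1 mul0r add0r; have [<-|] := eqVneq z z'; last by rewrite mul0r eqxx.
  rewrite mul1r => /label_rate_neq0[j [->|->]]; [left|right]; by exists j.
rewrite !finite_setU; split; first by apply: finite_image; exact: finite_interfaces.
by split; apply: finite_image; exact: finite_finset.
Qed.

(** * Finiteness of the total flux *)

Definition interfaces z : \bar R := \esum_(i in [set: int]) (z i != z (i + 1))%:R%:E.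

(** Every interface allows one particle jump and every label two moves, all of rate at most 1. *)
Lemma exit_rate_le (S : set (config * d.-tuple int)) a :
  (\esum_(b in S) (coupled_rate q a b)%:E <= interfaces a.1 + (d + d)%:R%:E)%E.
Proof.
case: a => z x; rewrite /coupled_rate/=.
have nat_le (u v : bool) : (u -> v) -> u%:R <= v%:R :> R.
  by case: u v => [] [] // /(_ isT).
under eq_esum do rewrite EFinD.
rewrite esumD; last 2 first.
- by move=> b _; rewrite lee_fin mulr_ge0// asep_rate_ge0.
- by move=> b _; rewrite lee_fin mulr_ge0// label_rate_ge0.
apply: leeD.
  apply: (@le_trans _ _ (\esum_(b in S) \esum_(i in [set: int])
     ((z i != z (i + 1))%:R * (b == (swap i z, x))%:R)%:E)%E).
    apply: le_esum => -[z' x'] _; rewrite /= asep_rateE mulr_fsuml.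
    apply: le_trans (fsum_le_esum _ _) _.
      by move=> i; rewrite !mulr_ge0// jump_rate_ge0.
    apply: le_esum => i _; rewrite lee_fin -mulrA xpair_eqE (eq_sym x) -(mulnb (z' == _)) natrM.
    by rewrite ler_wpM2r// jump_rate_le.
  rewrite esum_exchange; last by move=> *; rewrite lee_fin mulr_ge0.
  by apply: le_esum => i _; exact: esum_indic.
apply: (@le_trans _ _ (\esum_(b in S) \sum_(j < d)
    ((1 * (b == (z, up x j))%:R)%:E + (1 * (b == (z, down x j))%:R)%:E))%E).
  apply: le_esum => -[z' x'] _; rewrite /= label_rateE.
  under eq_bigr do rewrite -EFinD.
  rewrite sumEFin lee_fin mulr_sumr; apply: ler_sum => j _.
  rewrite !xpair_eqE (eq_sym z) !mul1r mulrDr -!(mulnb (z' == _)) !natrM lerD// ler_wpM2l//.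
    apply: (@le_trans _ _ (up_ok z x j x')%:R); first by rewrite ler_piMl// ltW.
    by apply: nat_le => /and3P[].
  by apply: nat_le => /and4P[].
rewrite esum_sum; last by move=> *; rewrite -EFinD lee_fin addr_ge0// mul1r.
apply: (@le_trans _ _ (\sum_(j < d) (2%:R)%:E)%E).
  apply: lee_sum => j _; rewrite esumD.
  - by rewrite -[2%:R]/(1 + 1) EFinD leeD// esum_indic.
  - by move=> *; rewrite lee_fin mul1r.
  - by move=> *; rewrite lee_fin mul1r.
by rewrite sumEFin lee_fin big_const card_ord iter_addr_0 -mulrnA mul2n addnn.
Qed.

Lemma mu_site (i : int) (b : bool) :
  (mu [set z : config | z i = b] <= (weight q c i ^ (if b then 1 else -1))%:E)%E.
Proof.
have := @hmu [:: i] (fun=> b) isT; rewrite big_seq1 => e.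
rewrite (_ : [set z : config | z i = b] =
    [set z : config | forall j, j \in [:: i] -> z j = b]).
  rewrite e lee_fin /density -/(weight q c i).
  have w0 := weight_gt0 c hq i; have w1 : 0 < 1 + weight q c i by rewrite addr_gt0.
  case: b {e}; first by rewrite expr1z ler_pdivrMr// mulrDr mulr1 lerDl mulr_ge0// ltW.
  rewrite exprN1 (_ : 1 - _ = (1 + weight q c i)^-1).
    by rewrite lef_pV2 ?posrE// lerDr.
  by field; rewrite gt_eqF.
apply/seteqP; split => z /=; first by move=> zi j; rewrite inE => /eqP->.
by apply; rewrite inE.
Qed.

(** An interface has both a particle and a hole among [i] and [i + 1]. Holes are rare far right and
    particles rare far left, so the hole is used for [i >= 0] and the particle for [i < 0]; the
    constant adds the two bounds. *)
Lemma pr_interface_le : exists2 K : R, 0 <= K &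
  forall i : int, pr mu (Omega `&` [set z | z i != z (i + 1)]) <= K * q ^+ `|i|%N.
Proof.
have Q0 : 0 < q `^ c by rewrite powR_gt0.
exists (2 / q `^ c + (q `^ c + q `^ c / q)) => [|i].
  by rewrite !addr_ge0 ?divr_ge0 ?ltW.
have le (b : bool) : pr mu (Omega `&` [set z | z i != z (i + 1)]) <=
    weight q c i ^ (if b then 1 else -1) + weight q c (i + 1) ^ (if b then 1 else -1).
  rewrite -lee_fin -prE; last by move=> z [].
  apply: (@le_trans _ _ (mu ([set z : config | z i = b] `|` [set z : config | z (i + 1) = b]))).
    apply: le_measure; rewrite ?inE.
    - by apply: measurable_sub_Omega => z [].
    - by apply: measurableU; exact: measurable_coordinate.
    - by move=> z [_ /=]; case: (z i) (z (i + 1)) b => [] [] [] //= _; [left|right|right|left].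
  apply: le_trans (measureU2 _ _ _) _; [exact: measurable_coordinate..|].
  by rewrite EFinD leeD// mu_site.
rewrite mulrDl; have qi0 : 0 < q ^+ `|i|%N by rewrite exprn_gt0.
have [i0|i0] := leP 0 i.
  have := le false; rewrite !exprN1 !weightE// !invfM !invr_expz !opprK.
  have -> : q ^ i = q ^+ `|i|%N by rewrite exprnP; congr (_ ^ _); lia.
  have -> : q ^ (i + 1) = q * q ^+ `|i|%N by rewrite -exprS exprnP; congr (_ ^ _); lia.
  move=> h; apply: le_trans h _; rewrite -[leLHS]addr0 lerD//; last first.
    by rewrite mulr_ge0 ?addr_ge0 ?divr_ge0 ?ltW.
  have : (q `^ c)^-1 * (q * q ^+ `|i|%N) <= (q `^ c)^-1 * q ^+ `|i|%N.
    by rewrite ler_pM2l ?invr_gt0// ler_piMl// ltW.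
  set u := _^-1; set v := q ^+ _; lra.
have := le true; rewrite !expr1z !weightE//.
have -> : q ^ (- i) = q ^+ `|i|%N by rewrite exprnP; congr (_ ^ _); lia.
have -> : q ^ (- (i + 1)) = q ^+ `|i|%N / q.
  by rewrite exprnP -[q^-1]exprN1 -expfzDr//; congr (_ ^ _); lia.
move=> h; apply: le_trans h _; rewrite -[leLHS]add0r lerD//.
  by rewrite mulr_ge0 ?divr_ge0 ?ltW.
by rewrite mulrDl lerD// mulrA mulrAC.
Qed.

Lemma esum_interfaces_lty :
  (\esum_(z in Omega) ((pr mu [set z])%:E * interfaces z) < +oo)%E.
Proof.
have [K K0 KP] := pr_interface_le.
apply: (@le_lt_trans _ _ (\esum_(i in [set: int]) (K * q ^+ `|i|%N)%:E)%E); last first.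
  rewrite (esumID [set i : int | 0 <= i]); last first.
    by move=> i _; rewrite lee_fin mulr_ge0// exprn_ge0// ltW.
  rewrite !setTI (@reindex_esum _ _ _ [set: nat] [set i : int | 0 <= i] Posz); last first.
    split; [by []|by move=> i j _ _ []|].
    by move=> [i|i]//= _; exists i.
  rewrite (@reindex_esum _ _ _ [set: nat] (~` [set i : int | 0 <= i]) Negz); last first.
    split; [by move=> i _ /=; rewrite NegzE; lia|by move=> i j _ _ []|].
    by move=> [i|i]//= h; exists i.
  under eq_esum do rewrite absz_nat.
  under [X in (_ + X)%E]eq_esum do rewrite /= exprS mulrA.
  by rewrite !esum_geometric ?ltry ?mulr_ge0// ltW.
apply: (@le_trans _ _ (\esum_(z in Omega) \esum_(i in [set: int])
    ((pr mu [set z]) * (z i != z (i + 1))%:R)%:E)%E).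
  apply: le_esum => z _; rewrite -ge0_esumZl ?pr_ge0//.
rewrite esum_exchange; last by move=> *; rewrite lee_fin mulr_ge0// pr_ge0.
apply: le_esum => i _.
apply: (@le_trans _ _ (pr mu (Omega `&` [set z | z i != z (i + 1)]))%:E); last first.
  by rewrite lee_fin KP.
have sO : Omega `&` [set z | z i != z (i + 1)] `<=` Omega by move=> z [].
rewrite -prE// mu_esum// (esum_mkcondr Omega); apply: le_esum => z Oz.
case: ifPn; first by rewrite inE /= => ->; rewrite mulr1.
by rewrite notin_setE /= => /negP/negPf ->; rewrite mulr0.
Qed.

(** The weight factorises, and the exit rate is bounded by a function of the configuration alone:
    the sum splits into the mean number of interfaces plus a constant, times the total label
    weight. *)
Lemma coupled_flux_lty : (\esum_(a in coupled_space d) \esum_(b in coupled_space d)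
  (coupled_weight a * coupled_rate q a b)%:E < +oo)%E.
Proof.
have W0 x : 0 <= label_weight q x := ltW (label_weight_gt0 hq x).
have i0 z : (0 <= interfaces z)%E by apply: esum_ge0 => i _; rewrite lee_fin.
pose E z := (interfaces z + (d + d)%:R%:E)%E.
have E0 z : (0 <= E z)%E by rewrite adde_ge0.
apply: (@le_lt_trans _ _ (\esum_(a in Omega `*`` (fun=> Zplus d))
    ((label_weight q a.2)%:E * ((pr mu [set a.1])%:E * E a.1)))%E).
  have -> : coupled_space d = Omega `*`` (fun=> Zplus d).
    by apply/seteqP; split => -[z x] [].
  apply: le_esum => -[z x] [Oz Zx].
  under eq_esum do rewrite EFinM.
  rewrite ge0_esumZl; last 2 first.
  - by move=> b _; rewrite lee_fin coupled_rate_ge0.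
  - by rewrite mulr_ge0// pr_ge0.
  rewrite /coupled_weight [(_ * label_weight q _)%R]mulrC EFinM -muleA.
  rewrite lee_wpmul2l ?lee_fin// lee_wpmul2l ?lee_fin ?pr_ge0//.
  exact: exit_rate_le.
rewrite -(@esum_esum _ _ _ Omega (fun=> Zplus d) (fun z x =>
    ((label_weight q x)%:E * ((pr mu [set z])%:E * E z))%E)); last first.
  by move=> z x _ _; rewrite !mule_ge0// lee_fin ?pr_ge0.
have Gfin : (\esum_(z in Omega) ((pr mu [set z])%:E * E z) < +oo)%E.
  under eq_esum do rewrite ge0_muleDr//.
  rewrite esumD; last 2 first.
  - by move=> z _; rewrite mule_ge0// lee_fin pr_ge0.
  - by move=> z _; rewrite mule_ge0// lee_fin pr_ge0.
  rewrite lte_add_pinfty//; first exact: esum_interfaces_lty.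
  under eq_esum do rewrite muleC.
  rewrite ge0_esumZl//; last by move=> z _; rewrite lee_fin pr_ge0.
  by rewrite -mu_esum// prE// -EFinM ltry.
rewrite esum_exchange; last first.
  by move=> z x _ _; rewrite !mule_ge0// lee_fin ?pr_ge0.
pose G := (\esum_(z in Omega) ((pr mu [set z])%:E * E z))%E.
have inner x : (\esum_(z in Omega) ((label_weight q x)%:E * ((pr mu [set z])%:E * E z)) =
    (label_weight q x)%:E * G)%E.
  by apply: ge0_esumZl => // z _; rewrite mule_ge0// lee_fin pr_ge0.
under eq_esum do rewrite inner.
rewrite -/G in Gfin.
have /fineK <- : G \is a fin_num.
  rewrite ge0_fin_numE//; apply: esum_ge0 => z _.
  by rewrite mule_ge0// lee_fin pr_ge0.
under eq_esum do rewrite muleC.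
rewrite ge0_esumZl; last 2 first.
- by move=> x _; rewrite lee_fin.
- apply: fine_ge0; apply: esum_ge0 => z _.
  by rewrite mule_ge0// lee_fin pr_ge0.
by rewrite esum_label_weight// -EFinM ltry.
Qed.

End Coupled.

(** * Reaching the ground state *)

Lemma ordered_eq_gs z : Omega z -> (forall i, z i -> z (i + 1)) -> z = gs (N z).
Proof.
move=> Oz zS; have [s zs ls] := site_exists Oz (lexx 0).
have zgs : z = gs (s - 1).
  apply/funext => i; rewrite /gs; have [si|si] := leP s i.
    have -> : (s - 1 < i) by lia.
    by move: i si; apply: int_lt_ind => // i _ /zS.
  have -> : (s - 1 < i) = false by lia.
  by apply/negP => /(label_lt Oz)/(_ si); rewrite ls; have := label_ge0 z i; lia.
by rewrite {2}zgs N_gs.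
Qed.

Lemma N_swap i z : Omega z -> z i -> ~~ z (i + 1) -> N (swap i z) = N z.
Proof.
move=> Oz zi zi1; have Or : Omega (remp i z) by apply/Omega_remp.
rewrite swapE// N_addp//; last by rewrite /remp (negPf zi1) andbF.
by rewrite N_remp// addrK.
Qed.

Lemma label_swap i z l : Omega z -> z i -> ~~ z (i + 1) ->
  label z l = label (swap i z) l + (l == i + 1 : nat)%:Z.
Proof.
move=> Oz zi zi1; have Or : Omega (remp i z) by apply/Omega_remp.
have ri : ~~ remp i z i by rewrite /remp eqxx.
have ri1 : ~~ remp i z (i + 1) by rewrite /remp (negPf zi1) andbF.
by rewrite swapE// label_addp// -{1}(rempK zi) label_addp//; lia.
Qed.

(* Jumps to the right lower the labels, hence come to an end, and a
   configuration allowing no such jump is some [gs n]. *)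
Lemma right_jump_ind (P : config -> Prop) :
  (forall n, P (gs n)) ->
  (forall z i, Omega z -> z i -> ~~ z (i + 1) -> P (swap i z) -> P z) ->
  forall z, Omega z -> P z.
Proof.
move=> Pgs Pswap z Oz; have [B B0 [zl zr]] := Omega_bounds Oz.
have [b Bb] : exists b : nat, B = b%:Z by exists `|B|%N; lia.
rewrite {}Bb {B B0} in zl zr.
(* Right jumps preserve the bounds [zl] and [zr], so one window serves throughout; a jump from [i]
   to [i + 1] lowers [label] at [i + 1] by one and nowhere else. *)
pose energy y := (\sum_(l <- window b) `|label y l|)%N.
have [k] := ubnP (energy z).
elim: k z Oz zl zr => // k IH z Oz zl zr zk.
have [zS|] := pselect (forall i, z i -> z (i + 1)).
  by rewrite (ordered_eq_gs Oz zS).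
move=> /existsNP[i /not_implyP[zi /negP zi1]]; apply: (Pswap z i) => //.
have ib : - b%:Z <= i by have := zl i; rewrite zi; lia.
have i1b : i + 1 <= b%:Z by have := zr (i + 1); rewrite (negPf zi1); lia.
apply: IH; first exact: Omega_swap.
- move=> j jb; rewrite /swap; have -> : (j == i) = false by lia.
  by have -> : (j == i + 1) = false by [lia]; apply: zl.
- move=> j jb; rewrite /swap; have -> : (j == i) = false by lia.
  by have -> : (j == i + 1) = false by [lia]; apply: zr.
rewrite ltnS in zk; apply: leq_trans zk.
have iw : i + 1 \in window b by rewrite mem_window; lia.
rewrite /energy !(bigD1_seq (i + 1) iw (window_uniq b))/= -addSn leq_add//.
  have := label_swap (i + 1) Oz zi zi1; rewrite eqxx.
  by have := label_ge0 (swap i z) (i + 1); lia.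
by apply: leq_sum => l /negPf li; rewrite [label z l](label_swap l Oz zi zi1) li addr0.
Qed.

Section Labels.
Variable d : nat.
Implicit Types x : d.-tuple int.

Lemma lt_sorted_tnth x :
  sorted <%R x <-> forall i j : 'I_d, (i < j)%N -> tnth x i < tnth x j.
Proof.
split=> [sx i j ij|h].
  by rewrite !(tnth_nth 0) lt_sorted_ltn_nth// inE size_tuple ltn_ord.
rewrite lt_sorted_pairwise; apply/(pairwiseP 0) => i j; rewrite !inE size_tuple => id jd ij.
by have := h (Ordinal id) (Ordinal jd) ij; rewrite !(tnth_nth 0).
Qed.

Lemma Zplus_down x j : Zplus d x -> 0 <= tnth x j - 1 -> tnth x j - 1 \notin x ->
  Zplus d (down x j).
Proof.
move=> Zx k0 kx; have [/lt_sorted_tnth sx _] := Zx; split.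
  apply/lt_sorted_tnth => i i' ii'; rewrite !tnth_set_coord.
  have [e|ij] := eqVneq i j; have [e'|ij'] := eqVneq i' j.
  - by move: ii'; rewrite e e' ltnn.
  - by have := sx _ _ ii'; rewrite e; lia.
  - have := sx _ _ ii'; rewrite e' => h.
    have : tnth x i != tnth x j - 1.
      by apply: contraNneq kx => <-; exact: mem_tnth.
    lia.
  - exact: sx.
apply/allP => _ /tnthP[i ->]; rewrite tnth_set_coord.
by case: ifP => // _; exact: Zplus_ge0.
Qed.

Definition lowest : d.-tuple int := [tuple (nat_of_ord i)%:Z | i < d].

Lemma mem_lowest (k : int) : (k \in lowest) = (0 <= k < d%:Z).
Proof.
apply/tnthP/idP => [[i ->]|kd]; first by rewrite tnth_mktuple; have := ltn_ord i; lia.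
have kd' : (`|k|%N < d)%N by lia.
by exists (Ordinal kd'); rewrite tnth_mktuple /=; lia.
Qed.

Lemma Zplus_lowest : Zplus d lowest.
Proof.
split; first by apply/lt_sorted_tnth => i j; rewrite !tnth_mktuple.
by apply/allP => k; rewrite mem_lowest => /andP[].
Qed.

(** If no label can move down, the labels form a downward closed set of [d] naturals. *)
Lemma stuck_eq_lowest x : Zplus d x ->
  (forall j, 0 <= tnth x j - 1 -> tnth x j - 1 \in x) -> x = lowest.
Proof.
move=> Zx down; have ux := Zplus_uniq Zx.
have closed (k : nat) (i : nat) : k%:Z \in x -> (i <= k)%N -> i%:Z \in x.
  elim: k => [|k IH] kx; first by rewrite leqn0 => /eqP->.
  rewrite leq_eqVlt => /orP[/eqP->//|]; apply: IH.
  case/tnthP: kx => j e; have := down j; rewrite -e.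
  by have -> : k.+1%:Z - 1 = k%:Z by [lia]; apply; lia.
apply: val_inj; apply: lt_sorted_eq.
- by case: Zx.
- by case: Zplus_lowest.
apply: (uniq_min_size ux _ _).2; last by rewrite !size_tuple.
move=> k kx; rewrite mem_lowest.
have k0 : 0 <= k by move: kx => /tnthP[j ->]; exact: Zplus_ge0.
rewrite k0/=; have kE : k = `|k|%N%:Z by lia.
have : (size (map Posz (iota 0 `|k|.+1)) <= size x)%N.
  apply: uniq_leq_size; first by rewrite map_inj_uniq ?iota_uniq// => ? ? [].
  move=> v /mapP[i]; rewrite mem_iota => ik ->; apply: (closed `|k|%N); last by lia.
  by rewrite -kE.
by rewrite size_map size_iota size_tuple; lia.
Qed.

Lemma down_ind (P : d.-tuple int -> Prop) : P lowest ->
  (forall x j, Zplus d x -> 0 <= tnth x j - 1 -> tnth x j - 1 \notin x ->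
     P (down x j) -> P x) ->
  forall x, Zplus d x -> P x.
Proof.
move=> Pl Pd x; have [k] := ubnP (absz (\sum_j tnth x j)).
elim: k x => // k IH x xk Zx.
have [stuck|] := pselect (forall j, 0 <= tnth x j - 1 -> tnth x j - 1 \in x).
  by rewrite (stuck_eq_lowest Zx stuck).
move=> /existsNP[j /not_implyP[k0 /negP kx]]; apply: (Pd x j) => //.
have Zd := Zplus_down Zx k0 kx.
apply: IH => //; rewrite ltnS in xk; apply: leq_trans xk.
have : \sum_i tnth x i = \sum_i tnth (down x j) i + 1.
  rewrite (bigD1 j)//= [in RHS](bigD1 j)//= tnth_set_coord eqxx.
  rewrite [in RHS](eq_bigr (fun i => tnth x i)); first by lia.
  by move=> i /negPf ij; rewrite tnth_set_coord ij.
have : 0 <= \sum_i tnth (down x j) i.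
  by apply: sumr_ge0 => i _; exact: Zplus_ge0.
lia.
Qed.

End Labels.

(** The order of the moves matters: the configuration is ordered first, with labels fixed, because
    in [gs (N z)] consecutive particles are neighbours and no label move is blocked by distance. *)
Lemma coupled_connected (R : realType) (q : R) (d : nat) (f : config * d.-tuple int -> R) :
  0 < q < 1 ->
  (forall a b, coupled_space d a -> coupled_space d b -> 0 < coupled_rate q a b ->
     f a = f b) ->
  forall z x, Omega z -> Zplus d x -> f (z, x) = f (gs (N z), lowest d).
Proof.
move=> hq fE z x Oz Zx; transitivity (f (gs (N z), x)).
  move: z Oz; apply: right_jump_ind => [n|y i Oy yi yi1]; first by rewrite N_gs.
  rewrite N_swap// => <-; apply: fE => //; first by split => //; exact: Omega_swap.
  rewrite /coupled_rate /= eqxx mulr1 ltr_wpDr//.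
    by rewrite mulr_ge0// label_rate_ge0.
  by apply: asep_rate_swap_gt0; rewrite // yi (negPf yi1).
move: x Zx; apply: down_ind => // x j Zx k0 kx <-.
have Zd := Zplus_down Zx k0 kx.
apply: fE; [by split => //; exact: Omega_gs..|].
rewrite /coupled_rate /= eqxx mul1r ltr_wpDl ?mulr_ge0 ?asep_rate_ge0//.
rewrite label_rateE (bigD1 j)//= ltr_wpDr//.
  by apply: sumr_ge0 => i _; rewrite addr_ge0// mulr_ge0// ltW//; case/andP: hq.
rewrite ltr_wpDl//; first by rewrite mulr_ge0// ltW//; case/andP: hq.
rewrite /down_ok k0 kx eqxx /neighbours !site_gs//; last exact: Zplus_ge0.
have -> : `|N z + 1 + tnth x j - (N z + 1 + (tnth x j - 1))| == 1 by lia.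
by rewrite ltr01.
Qed.

(** * The formula *)

(** The [hat] of the sequence [b :: s], with index shifted by 2 (see [hat_gap]); a separate head
    suits the induction along a path. *)
Definition gap (b : int) (s : seq int) (i : nat) : int := nth 0 s i - nth 0 (b :: s) i - 1.

Lemma gapS b k s i : gap b (k :: s) i.+1 = gap k s i.
Proof. by []. Qed.

Lemma gap_ge0 b s i : path <%R b s -> (i < size s)%N -> 0 <= gap b s i.
Proof.
by elim: s b i => // k s IH b [|i] /= /andP[bk ks] si;
   [rewrite /gap /=; lia|rewrite gapS IH].
Qed.

Lemma sum_gap b s : \sum_(i < size s) (gap b s i + 1) = last b s - b.
Proof.
elim: s b => [|k s IH] b; first by rewrite big_ord0 subrr.
rewrite big_ord_recl /=; under eq_bigr do rewrite gapS.
by rewrite IH /gap /=; lia.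
Qed.

(** Summation by parts: increment [i] is counted by each of the [size s - i] entries from position
    [i] on. *)
Lemma sum_gap_weighted b s : \sum_(k <- s) k =
  (size s)%:Z * b + \sum_(i < size s) ((size s)%:Z - i%:Z) * (gap b s i + 1).
Proof.
elim: s b => [|k s IH] b; first by rewrite big_nil big_ord0 mul0r.
rewrite big_cons (IH k) /= big_ord_recl /=.
under [in RHS]eq_bigr do rewrite /bump /= gapS.
have -> : \sum_(i < size s) ((size s).+1%:Z - (1 + i)%N%:Z) * (gap k s i + 1) =
    \sum_(i < size s) ((size s)%:Z - i%:Z) * (gap k s i + 1).
  by apply: eq_bigr => i _; congr (_ * _); lia.
by rewrite /gap /=; lia.
Qed.

Lemma sum_rev_index (e : nat) : \sum_(i < e) (e%:Z - i%:Z) = 'C(e.+1, 2)%:Z.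
Proof.
elim: e => [|e IH]; first by rewrite big_ord0.
rewrite big_ord_recl /= subr0 binS bin1.
have -> : \sum_(i < e) (e.+1%:Z - (bump 0 i)%:Z) = \sum_(i < e) (e%:Z - i%:Z).
  by apply: eq_bigr => i _; rewrite /bump /=; lia.
by rewrite IH; lia.
Qed.

Lemma mul2_bin2 (g : nat) : 2 * 'C(g.+1, 2)%:Z = g%:Z * (g%:Z + 1).
Proof.
elim: g => [|g IH]; first by rewrite bin_small.
rewrite binS bin1 PoszD mulrDr IH; have -> : g.+1%:Z = g%:Z + 1 by lia.
by ring.
Qed.

Lemma divz_bin2 (g : nat) : ((g%:Z * (g%:Z + 1)) %/ 2)%Z = 'C(g.+1, 2)%:Z.
Proof. by rewrite -mul2_bin2 mulKz. Qed.

Lemma mem_zip1 (T1 T2 : eqType) (s : seq T1) (t : seq T2) p : p \in zip s t -> p.1 \in s.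
Proof.
elim: s t => [|x s IH] [|y t] //=; rewrite !inE => /orP[/eqP->|/IH->] /=;
  by rewrite ?eqxx ?orbT.
Qed.

Lemma path_zip_lt (m : int) (ms ks : seq int) : path <%R m ms ->
  forall p, p \in zip ms ks -> m < p.1.
Proof.
by move=> pm p /mem_zip1; apply: (allP (order_path_min lt_trans pm)).
Qed.

Lemma prod_exprz (F : fieldType) (x : F) (I : finType) (f : I -> int) : x != 0 ->
  \prod_i x ^ f i = x ^ (\sum_i f i).
Proof.
move=> x0; rewrite (big_morph (fun e : int => x ^ e) (id1 := 1) (op1 := *%R))//.
by move=> a b; rewrite expfzDr.
Qed.

Section Formula.
Variables (R : realType) (q c : R) (mu : probability configS R).
Hypotheses (hq : 0 < q < 1) (hmu : is_product_measure q c mu).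

Let q0 : 0 < q. Proof. by case/andP: hq. Qed.
Let qN0 : q != 0. Proof. by rewrite gt_eqF. Qed.

Lemma pr_marked_zip (n a b : int) (ms ks : seq int) : size ms = size ks ->
  path <%R a ms -> path <%R b ks ->
  pr mu (marked n a b (zip ms ks)) =
  (\prod_(i < size ks) (block_weight q c `|gap b ks i|%N (nth 0 ms i) *
     weight q c (nth 0 ms i) * qbinom q (gap a ms i) (gap b ks i)))
  * pr mu (marked (n + (last b ks - b)) (last a ms) b [::]).
Proof.
elim: ms ks n a b => [|m ms IH] [|k ks]// n a b; first by rewrite big_ord0 mul1r subrr addr0.
move=> /= [sz] /andP[am pm] /andP[bk pk].
rewrite (pr_marked_cons hq hmu)//; last exact: path_zip_lt.
rewrite IH// big_ord_recl /= mulrA; congr (_ * pr mu _); last first.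
  rewrite (marked_nil _ _ k b); congr (marked _ _ _ _); lia.
by rewrite /gap /= [X in X * _ = _]mulrAC -!(addrA _ (- _)).
Qed.

Lemma block_weight_mul (g : nat) (m : int) : block_weight q c g m * weight q c m =
  (q `^ c) ^+ g.+1 * q ^ ('C(g.+1, 2)%:Z - g.+1%:Z * m).
Proof.
rewrite /block_weight weightE// exprSr mulrACA -expfzDr//; congr (_ * _ ^ _); lia.
Qed.

Lemma pr_pinned_zip (n m1 : int) (k1 : nat) (ms ks : seq int) :
  size ms = size ks -> path <%R m1 ms -> path <%R k1%:Z ks ->
  pr mu (pinned n (zip (m1 :: ms) (k1%:Z :: ks))) =
  if last m1 ms <= n + last k1%:Z ks + 1 then
    pr mu [set gs n] *
    (q ^ ('C(k1.+1, 2)%:Z - k1.+1%:Z * m1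
        + \sum_(i < size ks) ('C(`|gap k1%:Z ks i|.+1, 2)%:Z - (gap k1%:Z ks i + 1) * nth 0 ms i)
        + 'C(`|last k1%:Z ks|.+1, 2)%:Z + (last k1%:Z ks + 1) * (n + 1))
     / (qpoch q `|(n - last m1 ms + last k1%:Z ks + 1)%R|%N * qpoch q k1)
     * \prod_(i < size ks) qbinom q (gap m1 ms i) (gap k1%:Z ks i))
  else 0.
Proof.
move=> sz pm pk; rewrite /= (pr_pinned_cons hq hmu); last exact: path_zip_lt.
rewrite pr_marked_zip// (pr_marked_nil hq hmu); set kd := last k1%:Z ks.
have kdE : k1%:Z <= kd.
  have := sum_gap k1%:Z ks; rewrite -/kd => e.
  have : 0 <= kd - k1%:Z; last by lia.
  by rewrite -e sumr_ge0// => i _; have := gap_ge0 pk (ltn_ord i); lia.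
have -> : n + k1%:Z + 1 + (kd - k1%:Z) = n + kd + 1 by lia.
case: ifP => _; last by rewrite !mulr0.
(* The particles up to the last prescribed site number [kd + 1]; rewriting mu{[gs n]} through
   [gs (n + kd + 1)] produces the same power of q^c on the other side. *)
rewrite -(pr_gsD hq hmu n `|(kd + 1)%R|%N).
have -> : n + `|(kd + 1)%R|%N%:Z = n + kd + 1 by lia.
have -> : n - last m1 ms + kd + 1 = n + kd + 1 - last m1 ms by lia.
rewrite big_split/=; set PB := \prod_(i < _) qbinom _ _ _.
set D := qpoch q `|_|%N; set G := pr mu [set gs _].
have -> : \prod_(i < size ks)
    (block_weight q c `|gap k1%:Z ks i|%N (nth 0 ms i) * weight q c (nth 0 ms i)) =
   (q `^ c) ^ (kd - k1%:Z) * q ^ (\sum_(i < size ks)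
     ('C(`|gap k1%:Z ks i|.+1, 2)%:Z - (gap k1%:Z ks i + 1) * nth 0 ms i)).
  rewrite -sum_gap; under eq_bigr do rewrite block_weight_mul.
  rewrite big_split/= -!prod_exprz ?gt_eqF ?powR_gt0//; congr (_ * _); apply: eq_bigr => i _.
    by rewrite exprnP; congr (_ ^ _); have := gap_ge0 pk (ltn_ord i); lia.
  congr (q ^ (_ - _ * _)); have := gap_ge0 pk (ltn_ord i); lia.
set X := \sum_(i < _) _; set Q := q `^ c; have QN0 : Q != 0 by rewrite gt_eqF ?powR_gt0.
have bw1 := block_weight_mul k1 m1.
transitivity (G * (block_weight q c k1 m1 * weight q c m1 *
    (Q ^ (kd - k1%:Z) * q ^ X)) / (D * qpoch q k1) * PB).
  by rewrite invfM; ring.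
rewrite bw1 /block_weight -/Q; set I := (_ * qpoch q k1)^-1.
have QE : Q ^+ k1.+1 * Q ^ (kd - k1%:Z) = Q ^+ `|(kd + 1)%R|%N.
  by rewrite !exprnP -expfzDr//; congr (_ ^ _); lia.
set g := `|kd|%N; have gE : kd = g%:Z by rewrite /g; lia.
have g1E : `|(kd + 1)%R|%N = g.+1 by rewrite /g; lia.
rewrite g1E in QE *; set A := q ^ (_ - _ * m1); set B := q ^ (_ - _ * (n + kd + 1 + 1)).
set E := q ^ (_ + _ * (n + 1)).
have qE : A * q ^ X = B * E.
  rewrite /A /B /E -!expfzDr//; congr (_ ^ _).
  have h := mul2_bin2 g; rewrite (binS g.+1) bin1 gE; move: h.
  set b := 'C(g.+1, 2); set b1 := 'C(k1.+1, 2) => h.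
  rewrite PoszD; have -> : g.+1%:Z = g%:Z + 1 by lia.
  move: h; move: (g%:Z) (b%:Z) (b1%:Z) => g' b' b1' h.
  apply/eqP; rewrite -subr_eq0; apply/eqP.
  transitivity (g' * (g' + 1) - 2 * b'); [by ring|by rewrite h subrr].
transitivity (G * (Q ^+ k1.+1 * Q ^ (kd - k1%:Z)) * (A * q ^ X) * I * PB); first by ring.
by rewrite QE qE; ring.
Qed.

End Formula.

Lemma co_last (m1 : int) (ms : seq int) : co (m1 :: ms) (size ms).+1 = last m1 ms.
Proof. by rewrite /co (last_nth 0). Qed.

Lemma hat_gap (k1 : int) (ks : seq int) i : hat (k1 :: ks) i.+2 = gap k1 ks i.
Proof. by []. Qed.

Lemma sum_co (s : seq int) : \sum_(1 <= i < (size s).+1) co s i = \sum_(k <- s) k.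
Proof. by rewrite big_add1 [RHS](big_nth 0). Qed.

(** Gaps of [ks] not exceeding those of [ms] make the difference m_j - k_j nondecreasing in j. *)
Lemma le_gap_last (a b : int) (ms ks : seq int) : size ms = size ks ->
  (forall i, (i < size ks)%N -> gap b ks i <= gap a ms i) ->
  forall j, (j <= size ks)%N ->
  nth 0 (a :: ms) j - nth 0 (b :: ks) j <= last a ms - last b ks.
Proof.
elim: ms ks a b => [|m ms IH] [|k ks]// a b; first by move=> _ _ [].
move=> [sz] le j; have le0 := le 0%N isT.
have le1 i : (i < size ks)%N -> gap k ks i <= gap m ms i by move=> ik; exact: (le i.+1).
case: j => [|j] /= jk; last exact: (IH _ _ _ sz le1).
have := IH _ _ _ sz le1 0%N isT => /=.
by move: le0; rewrite /gap /=; lia.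
Qed.

(** Bookkeeping of exponents of [q], with the sum of labels expressed through gaps. The binomial
    term cancels the ones in [gap + 1]; [f] stands for the quadratic terms common to both sides. *)
Lemma label_exponent (k1 m1 : int) (ms ks : seq int) (f : nat -> int) : size ms = size ks ->
  - 'C((size ks).+1, 2)%:Z + \sum_(k <- k1 :: ks) k - (k1 + 1) * m1
   + \sum_(i < size ks) (f i - (gap k1 ks i + 1) * nth 0 ms i) =
  - \sum_(m <- m1 :: ms) m + k1 * ((size ks).+1%:Z - m1)
   + \sum_(i < size ks) (gap k1 ks i * ((size ks).+1%:Z + 1 - i.+2%:Z - nth 0 ms i) + f i).
Proof.
move=> sz; rewrite !big_cons (sum_gap_weighted k1) -sum_rev_index.
rewrite [\sum_(m <- ms) m](big_nth 0) sz big_mkord.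
set S1 := \sum_(i < _) ((size ks)%:Z - i%:Z); set S2 := \sum_(i < _) (_ * (_ + 1)).
set S3 := \sum_(i < _) (f i - _); set S4 := \sum_(i < _) nth 0 ms i.
set S5 := \sum_(i < _) (_ + f i).
suff : S2 + S3 + S4 - S1 = S5.
  move=> <-; rewrite (_ : (size ks).+1%:Z = (size ks)%:Z + 1); last by lia.
  by ring.
rewrite /S1 /S2 /S3 /S4 /S5 -!big_split -sumrB /=; apply: eq_bigr => i _.
rewrite (_ : (size ks).+1%:Z = (size ks)%:Z + 1); last by lia.
by rewrite (_ : i.+2%:Z = i%:Z + 2); [ring|lia].
Qed.

Section Matching.
Variables (R : realType) (q c : R) (mu : probability configS R).
Hypotheses (hq : 0 < q < 1) (hmu : is_product_measure q c mu).

Let q0 : 0 < q. Proof. by case/andP: hq. Qed.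
Let qN0 : q != 0. Proof. by rewrite gt_eqF. Qed.

Definition summand (d : nat) (n : int) (m k : seq int) : R :=
  q ^ ((co k 1 * (co k 1 + 1) %/ 2)%Z + co k 1 * (d%:Z - co m 1)
           + (co k d * (co k d + 1) %/ 2)%Z + (co k d + 1) * (n + 1))
      / (qpoch q `|(n - co m d + co k d + 1)%R|%N * qpoch q `|co k 1|%N)
      * \prod_(2 <= j < d.+1)
          (q ^ (hat k j * (d%:Z + 1 - j%:Z - co m j)
                + (hat k j * (hat k j + 1) %/ 2)%Z)
           * qbinom q (hat m j) (hat k j)).

Definition admissible (d : nat) (n : int) (m k : seq int) : Prop :=
  forall j, (1 <= j <= d)%N -> (co m j - n - 1 <= co k j)%R.

Lemma pr_pinned_summand (n m1 : int) (k1 : nat) (ms ks : seq int) :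
  let d := (size ks).+1 in let m := m1 :: ms in let k := k1%:Z :: ks in
  size ms = size ks -> path <%R m1 ms -> path <%R k1%:Z ks ->
  pr mu (pinned n (zip m k)) * (q ^- 'C(d, 2) * q ^ (\sum_(i <- k) i)) =
  if last m1 ms <= n + last k1%:Z ks + 1 then
    q ^ (- \sum_(1 <= i < d.+1) co m i) * pr mu [set gs n] * summand d n m k
  else 0.
Proof.
move=> d m k sz pm pk; rewrite (pr_pinned_zip hq hmu)//; case: ifP => _; last by rewrite mul0r.
have lm : co m d = last m1 ms by rewrite /d -sz co_last.
have lk : co k d = last k1%:Z ks by rewrite co_last.
have sm : \sum_(1 <= i < d.+1) co m i = \sum_(i <- m) i by rewrite -sum_co /= sz.
rewrite /summand lm lk sm; set kd := last k1%:Z ks.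
have [g gE] : exists g : nat, kd = g%:Z.
  exists `|kd|%N; have := sum_gap k1%:Z ks; rewrite -/kd => E.
  suff : 0 <= kd - k1%:Z by lia.
  by rewrite -E sumr_ge0// => i _; have := gap_ge0 pk (ltn_ord i); lia.
have ck : co k 1 = k1%:Z by [].
have cm : co m 1 = m1 by [].
rewrite ck cm gE !divz_bin2 !absz_nat.
rewrite big_add1 big_add1 big_mkord -[d.+1.-1.-1]/(size ks).
rewrite [\prod_(i < _) (_ * _)]big_split/= prod_exprz//.
pose f i : int := 'C(`|gap k1%:Z ks i|.+1, 2)%:Z.
have := @label_exponent k1%:Z m1 ms ks f sz; rewrite -/d -/m -/k.
set Sk := \sum_(i <- k) i; set Sm := \sum_(i <- m) i.
set S3 := \sum_(i < _) (f i - _); set S5 := \sum_(i < _) (_ + f i) => eE.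
have -> : \sum_(i < size ks) (hat k i.+2 * (d%:Z + 1 - i.+2%:Z - co m i.+2) +
    (hat k i.+2 * (hat k i.+2 + 1) %/ 2)%Z) = S5.
  apply: eq_bigr => i _; rewrite hat_gap; congr (_ + _).
  have [h hE] : exists h : nat, gap k1%:Z ks i = h%:Z.
    by exists `|gap k1%:Z ks i|%N; have := gap_ge0 pk (ltn_ord i); lia.
  by rewrite /f hE divz_bin2 absz_nat.
set D := qpoch q _ * qpoch q _; set G := pr mu _; set PB := \prod_(i < _) _.
rewrite exprnN.
set e1 := _ + S3 + _ + _; set e2 := _ + k1%:Z * _ + _ + _.
have qE : q ^ e1 * (q ^ (- 'C(d, 2)%:Z) * q ^ Sk) = q ^ (- Sm) * (q ^ e2 * q ^ S5).
  rewrite -!expfzDr//; congr (_ ^ _); rewrite /e1 /e2.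
  have e0 : k1.+1%:Z = k1%:Z + 1 by lia.
  rewrite e0; move: eE; rewrite -/d => eE.
  apply/eqP; rewrite -subr_eq0; move/eqP: eE; rewrite -subr_eq0 => /eqP eE.
  by apply/eqP; rewrite -eE; ring.
transitivity (G * (q ^ e1 * (q ^ (- 'C(d, 2)%:Z) * q ^ Sk)) / D * PB); first by ring.
by rewrite qE; ring.
Qed.

(** Given the bound at the last index, [le_gap_last] shows that a violation elsewhere needs a gap of
    [ks] larger than that of [ms], where the q-binomial vanishes. *)
Lemma inadmissible_summand (n m1 : int) (k1 : nat) (ms ks : seq int) :
  let d := (size ks).+1 in let m := m1 :: ms in let k := k1%:Z :: ks in
  size ms = size ks -> path <%R m1 ms -> path <%R k1%:Z ks ->
  last m1 ms <= n + last k1%:Z ks + 1 -> ~ admissible d n m k ->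
  summand d n m k = 0.
Proof.
move=> d m k sz pm pk lmk nadm; apply: contrapT => s0; apply: nadm.
have gaps i : (i < size ks)%N -> gap k1%:Z ks i <= gap m1 ms i.
  move=> ik; rewrite leNgt; apply/negP => h; apply: s0.
  rewrite /summand; have -> : \prod_(2 <= j < d.+1) (q ^ (hat k j * (d%:Z + 1 - j%:Z - co m j)
      + (hat k j * (hat k j + 1) %/ 2)%Z) * qbinom q (hat m j) (hat k j)) = 0;
    last by rewrite mulr0.
  rewrite big_add1 big_add1 big_mkord -[d.+1.-1.-1]/(size ks) (bigD1 (Ordinal ik))//=.
  rewrite !hat_gap.
  have gm := gap_ge0 pm; have gk := gap_ge0 pk ik; rewrite sz in gm.
  have -> : gap m1 ms i = `|gap m1 ms i|%N%:Z by have := gm i ik; lia.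
  have -> : gap k1%:Z ks i = `|gap k1%:Z ks i|%N%:Z by lia.
  by rewrite qbinom_small ?mulr0 ?mul0r//; have := gm i ik; lia.
move=> [|j]//= jd; have := le_gap_last sz gaps (j := j); rewrite -ltnS => /(_ jd).
rewrite -/m -/k /co /=; lia.
Qed.

End Matching.

Lemma countable_coupled_space d : countable (coupled_space d).
Proof.
have -> : coupled_space d =
    \bigcup_(x in Zplus d) ((fun z => (z, x)) @` Omega).
  apply/seteqP; split => [[z x] [Oz Zx]|_ [x Zx [z Oz <-]]//].
  by exists x => //; exists z.
apply: bigcup_countable; first exact: countableP.
by move=> x _; apply: sub_countable (card_image_le _ _) countable_Omega.
Qed.

Lemma N_event_pinned n : N_event n = pinned n [::].
Proof. by apply/seteqP; split => z; [move=> [? ?]|move=> [? ? _]]; split. Qed.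

Lemma positions_pinned d n (m k : d.-tuple int) : Zplus d k ->
  pinned n (zip m k) = [set z | [/\ Omega z, N z = n & positions z k = m]].
Proof.
move=> Zk; have sz : size m = size k by rewrite !size_tuple.
have siteE z (j : 'I_d) : Omega z ->
    site z (tnth k j) = tnth m j <-> z (tnth m j) /\ label z (tnth m j) = tnth k j.
  by move=> Oz; apply: siteP => //; exact: Zplus_ge0.
apply/seteqP; split => z.
  move=> [Oz Nz zl]; split => //; apply: eq_from_tnth => j; rewrite tnth_mktuple.
  apply/siteE => //; apply: (zl (tnth m j, tnth k j)).
  apply/(nthP (0, 0)); exists j; first by rewrite size_zip sz minnn size_tuple.
  by rewrite nth_zip// -!tnth_nth.
move=> [Oz Nz posm]; split => // p /(nthP (0, 0))[j].
rewrite size_zip sz minnn size_tuple => jd <-; rewrite nth_zip//=.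
have e := congr1 (fun y : d.-tuple int => tnth y (Ordinal jd)) posm.
rewrite tnth_mktuple in e.
by have := (siteE z (Ordinal jd) Oz).1 e; rewrite !(tnth_nth 0).
Qed.

(** * Positivity of point masses *)

Section Positivity.
Variables (R : realType) (q c : R) (mu : probability configS R).
Hypotheses (hq : 0 < q < 1) (hmu : is_product_measure q c mu).

(** By [pr_marked_nil] the sets exhausting {N = n} have mass proportional to mu{[gs n]}; were it 0,
    {N = n} would be null. *)
Lemma pr_gs_gt0 n : pr mu (N_event n) != 0 -> 0 < pr mu [set gs n].
Proof.
rewrite N_event_pinned lt_neqAle pr_ge0 andbT eq_sym; apply: contraNN => /eqP g0.
apply/eqP/esym; have h := @cvg_pinned R mu n [::]; apply: (cvg_unique _ h) => //.
rewrite (_ : (fun _ => _) = cst 0); first exact: cvg_cst.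
by apply/funext => B; rewrite (pr_marked_nil hq hmu) -g0 mul0r; case: ifP.
Qed.

(** Positivity passes between ground states by [pr_gsD] and from a ground state to the rest of its
    sector by undoing right jumps. *)
Lemma pr_gt0 n z : pr mu (N_event n) != 0 -> Omega z -> 0 < pr mu [set z].
Proof.
move=> /pr_gs_gt0 gn; move: z; apply: right_jump_ind => [m|z i Oz zi zi1 h].
  have [nm|mn] := leP n m.
    move: gn; rewrite -(pr_gsD hq hmu n `|(m - n)%R|%N) pmulr_rgt0 ?block_weight_gt0//.
    by have -> : n + `|(m - n)%R|%N%:Z = m by lia.
  rewrite -(pr_gsD hq hmu m `|(n - m)%R|%N) mulr_gt0 ?block_weight_gt0//.
  by have -> : m + `|(n - m)%R|%N%:Z = n by lia.
by rewrite (pr_swap hq hmu Oz zi zi1) mulr_gt0//; case/andP: hq.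
Qed.

End Positivity.

(** * The stationary law *)

Section Stationary.
Variables (R : realType) (q : R) (d : nat) (n : int) (c : R).
Variables (mu : probability configS R) (dW : measure_display).
Variables (W : measurableType dW) (P : probability W R).
Variables (xi : R -> W -> config) (x : R -> W -> d.-tuple int) (t : R).
Hypotheses (hq : 0 < q < 1) (hmu : is_product_measure q c mu).
Hypotheses (hsys : coupled_system q P xi x).
Hypotheses (hstat : stationary P (fun t w => (xi t w, x t w))) (ht : 0 <= t).
Hypothesis hxi : forall A : set configS, measurable A ->
    P [set w | A (xi t w)] = nu mu n A.

Let q0 : 0 < q. Proof. by case/andP: hq. Qed.

Let Y w := (xi t w, x t w).

Definition law a : R := fine (P [set w | Y w = a]).

Let YS w : coupled_space d (Y w).
Proof. by have [h _ _ _ _] := hsys; exact: h. Qed.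

Let mY a : measurable [set w | Y w = a].
Proof. by have [_ h _ _ _] := hsys; exact: h. Qed.

Lemma lawE a : P [set w | Y w = a] = (law a)%:E.
Proof. by rewrite /law fineK// fin_num_measure. Qed.

Lemma law_ge0 a : 0 <= law a.
Proof. exact: fine_ge0. Qed.

Lemma prob_law (A : set (config * d.-tuple int)) : A `<=` coupled_space d ->
  (P [set w | A (Y w)] = \esum_(a in A) (law a)%:E)%E.
Proof.
move=> AS; rewrite (@measure_preimage_esum dW W R P _ Y A).
- by apply: eq_esum => a _; exact: lawE.
- exact: sub_countable (subset_card_le AS) (countable_coupled_space d).
- by move=> a _; exact: mY.
Qed.

(** On the whole space [hxi] reads 1 = x / x with x the mass of {N = n}; as division by 0 gives 0, x
    is nonzero. *)
Lemma pr_N_event_neq0 : pr mu (N_event n) != 0.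
Proof.
have := @hxi setT measurableT; rewrite /nu setTI.
rewrite (_ : [set w | _] = setT) ?probability_setT; last by apply/seteqP; split.
by move=> [h]; apply: contra_eqN h => /eqP; rewrite /pr => ->; rewrite mul0r oner_eq0.
Qed.

Lemma marginal z : Omega z -> (\esum_(k in Zplus d) (law (z, k))%:E =
  (pr mu ([set z] `&` N_event n) / pr mu (N_event n))%:E)%E.
Proof.
move=> Oz; transitivity (P [set w | [set z] (xi t w)]); last first.
  by rewrite hxi//; exact: measurable_set1_configS.
have -> : [set w | [set z] (xi t w)] = [set w | ((fun k => (z, k)) @` Zplus d) (Y w)].
  apply/seteqP; split => w /=; last by move=> [k _ []].
  by move=> <-; exists (x t w) => //; have [] := YS w.
rewrite prob_law; last by move=> _ [k Zk <-].
by rewrite esum_image// => k k' _ _ [].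
Qed.

Lemma law_off z k : Omega z -> Zplus d k -> N z != n -> law (z, k) = 0.
Proof.
move=> Oz Zk Nz; apply/eqP; rewrite eq_le law_ge0 andbT.
have := marginal Oz; rewrite (_ : [set z] `&` N_event n = set0); last first.
  by apply/seteqP; split => // y [-> [_ /= h]]; rewrite h eqxx in Nz.
rewrite /pr measure0 mul0r => h; rewrite -lee_fin -h; apply: esum_ge.
by exists [set k]; [split => // _ ->|rewrite fsbig_set1].
Qed.

Let weight_gt0 a : coupled_space d a -> 0 < coupled_weight q mu a.
Proof.
move=> [Oz _]; rewrite mulr_gt0 ?label_weight_gt0//.
exact: (pr_gt0 hq hmu pr_N_event_neq0).
Qed.

Lemma law_ratio_edge a b : coupled_space d a -> coupled_space d b ->
  0 < coupled_rate q a b ->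
  law a / coupled_weight q mu a = law b / coupled_weight q mu b.
Proof.
have r0 := coupled_rate_ge0 hq (d := d).
apply: (superinvariant_const r0 weight_gt0).
- by move=> e _; exact: law_ge0.
- by move=> e f; exact: coupled_rate_reversible hmu _ _.
- exact: (coupled_flux_lty d hq hmu).
move=> e Se; apply: (superinvariant hsys hstat) => //.
- by move=> f _; exact: coupled_rateaa.
- by move=> f; exact: coupled_rate_finite.
Qed.

(** The constant is fixed by the marginal at [gs n]: the leading quotient is the inverse of the
    total label weight. *)
Lemma law_weight z k : Omega z -> N z = n -> Zplus d k ->
  law (z, k) = qpoch q d / q ^+ 'C(d, 2) / pr mu (N_event n) * coupled_weight q mu (z, k).
Proof.
have ratio y l : Omega y -> N y = n -> Zplus d l -> law (y, l) =
    law (gs n, lowest d) / coupled_weight q mu (gs n, lowest d) * coupled_weight q mu (y, l).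
  move=> Oy Ny Zl.
  have := coupled_connected (f := fun a => law a / coupled_weight q mu a) hq law_ratio_edge Oy Zl.
  by rewrite Ny => <-; rewrite divfK// gt_eqF// weight_gt0.
move: ratio; set C := law _ / _ => ratio Oz Nz Zk; rewrite ratio//; congr (_ * _).
have C0 : 0 <= C.
  by rewrite divr_ge0 ?law_ge0// ltW// weight_gt0//; split; [exact: Omega_gs|exact: Zplus_lowest].
have := marginal (Omega_gs n); rewrite setIidl; last first.
  by move=> _ ->; split; [exact: Omega_gs|exact: N_gs].
rewrite (eq_esum (b := fun k => ((C * pr mu [set gs n])%:E * (label_weight q k)%:E)%E)); last first.
  by move=> l Zl; rewrite ratio ?N_gs//; [rewrite /coupled_weight mulrA EFinM|exact: Omega_gs].
have g0 := pr_gs_gt0 hq hmu pr_N_event_neq0.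
rewrite ge0_esumZl; last 2 first.
- by move=> l _; rewrite lee_fin ltW// label_weight_gt0.
- by rewrite mulr_ge0 ?pr_ge0.
rewrite esum_label_weight// -EFinM => -[h].
have E : C * (q ^+ 'C(d, 2) / qpoch q d) = (pr mu (N_event n))^-1.
  by apply: (mulfI (lt0r_neq0 g0)); rewrite -h mulrCA mulrA.
rewrite -[LHS](mulfK (x := q ^+ 'C(d, 2) / qpoch q d)) ?E; last first.
  by rewrite mulf_neq0 ?invr_neq0 ?gt_eqF ?exprn_gt0 ?qpoch_gt0.
by rewrite invf_div mulrC.
Qed.

Lemma prob_positions (m : d.-tuple int) :
  (P [set w | positions (xi t w) (x t w) = m] = \esum_(k in Zplus d)
    (qpoch q d / q ^+ 'C(d, 2) / pr mu (N_event n) *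
     (label_weight q k * pr mu (pinned n (zip m k))))%:E)%E.
Proof.
pose B (k : d.-tuple int) := [set z | Omega z /\ positions z k = m].
have K0 : 0 <= qpoch q d / q ^+ 'C(d, 2) / pr mu (N_event n).
  by rewrite !divr_ge0 ?pr_ge0 ?exprn_ge0// ltW// qpoch_gt0.
pose A := (fun p : d.-tuple int * config => (p.2, p.1)) @` (Zplus d `*`` B).
have -> : [set w | positions (xi t w) (x t w) = m] = [set w | A (Y w)].
  apply/seteqP; split => w /=; last by move=> [[k z] [/= Zk [Oz e]] [<- <-]].
  by move=> e; exists (x t w, xi t w) => //; have [/= Oz Zx] := YS w; split.
rewrite prob_law; last by move=> _ [[k z] [/= Zk [Oz _]] <-]; split.
rewrite esum_image; last by move=> [k z] [k' z'] _ _ [-> ->].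
rewrite -(@esum_esum _ _ _ _ _ (fun k z => (law (z, k))%:E)); last first.
  by move=> k z _ _; rewrite lee_fin law_ge0.
apply: eq_esum => k Zk; rewrite mulrA EFinM -prE; last by move=> z [].
rewrite mu_esum; last by move=> z [].
rewrite positions_pinned// -ge0_esumZl; last 2 first.
- by move=> z _; rewrite lee_fin pr_ge0.
- by rewrite mulr_ge0// ltW// label_weight_gt0.
have -> : [set z | [/\ Omega z, N z = n & positions z k = m]] = B k `&` [set z | N z = n].
  by apply/seteqP; split => z; [move=> [? ? ?]|move=> [[? ?] ?]].
rewrite (esum_mkcondr (B k)); apply: eq_esum => z [Oz _]; case: ifPn.
  rewrite inE /= => Nz; rewrite law_weight// -EFinM; congr EFin.
  by rewrite /coupled_weight/= -!mulrA [pr mu _ * _]mulrC.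
by rewrite notin_setE /= => /eqP Nz; rewrite law_off.
Qed.

End Stationary.

Lemma pr_positions_given_labels (R : realType) (q c : R) (mu : probability configS R)
    (hq : 0 < q < 1) (hmu : is_product_measure q c mu) (d : nat) (n : int)
    (m k : d.-tuple int) :
  (1 <= d)%N -> sorted <%R m -> Zplus d k ->
  pr mu (pinned n (zip m k)) * (q ^- 'C(d, 2) * label_weight q k) =
  if `[< admissible d n m k >] then
    q ^ (- \sum_(1 <= i < d.+1) co m i) * pr mu [set gs n] * summand q d n m k
  else 0.
Proof.
case: d m k => // e m k _; case/tupleP: m => m1 ms; case/tupleP: k => k1 ks.
move=> pm /Zplus_path /= /andP[k10 pk].
have [k1' k1E] : exists k1' : nat, k1 = k1'%:Z by exists `|k1|%N; lia.
rewrite {}k1E {k1 k10} in pk *.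
have szk : size ks = e := size_tuple ks.
have szm : size ms = size ks by rewrite !size_tuple.
have val := @pr_pinned_summand R q c mu hq hmu n m1 k1' ms ks szm pm pk.
have inadm := @inadmissible_summand R q hq n m1 k1' ms ks szm pm pk.
have lm : co (m1 :: ms) (size ks).+1 = last m1 ms by rewrite -szm co_last.
have lk : co (k1'%:Z :: ks) (size ks).+1 = last k1'%:Z ks by rewrite co_last.
rewrite /= szk in lm lk inadm val; rewrite /label_weight val /=.
(* For inadmissible [k] either the last bound fails and the pinned event is null, or [inadm] kills
   the summand. *)
case: asboolP => [adm|/[dup] nadm]; last by case: ifP => // lmk /(inadm lmk) ->; rewrite mulr0.
have := adm e.+1; rewrite /= lm lk ltnSn => /(_ isT) h.
by have -> : last m1 ms <= n + last k1'%:Z ks + 1 by lia.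
Qed.

Theorem proposition1p9
  (R : realType) (q : R) (hq : 0 < q < 1)
  (d : nat) (hd : (1 <= d)%N) (n : int)
  (c : R) (mu : probability configS R) (hmu : is_product_measure q c mu)
  (dW : measure_display) (W : measurableType dW) (P : probability W R)
  (xi : R -> W -> config) (x : R -> W -> d.-tuple int)
  (hsys : coupled_system q P xi x)
  (hstat : stationary P (fun t w => (xi t w, x t w)))
  (t : R) (ht : 0 <= t)
  (hxi : forall A : set configS, measurable A ->
    P [set w | A (xi t w)] = nu mu n A)
  (m : d.-tuple int) (hm : sorted <%R m) :
  (P [set w | positions (xi t w) (x t w) = m] =
   (q ^ (- \sum_(1 <= i < d.+1) co m i) * qpoch_oo q
      * \prod_(1 <= i < d.+1) (1 - q ^+ i))%:E *
   \esum_(k in [set k : d.-tuple int | Zplus d k /\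
       forall j, (1 <= j <= d)%N -> (co m j - n - 1 <= co k j)%R])
     (q ^ ((co k 1 * (co k 1 + 1) %/ 2)%Z + co k 1 * (d%:Z - co m 1)
           + (co k d * (co k d + 1) %/ 2)%Z + (co k d + 1) * (n + 1))
      / (qpoch q `|(n - co m d + co k d + 1)%R|%N * qpoch q `|co k 1|%N)
      * \prod_(2 <= j < d.+1)
          (q ^ (hat k j * (d%:Z + 1 - j%:Z - co m j)
                + (hat k j * (hat k j + 1) %/ 2)%Z)
           * qbinom q (hat m j) (hat k j)))%:E)%E.
Proof.
have prN0 := pr_N_event_neq0 hxi.
have g0 : 0 < pr mu [set gs n] := pr_gs_gt0 hq hmu prN0.
have q0 : 0 < q by case/andP: hq.
have gE : pr mu (N_event n) * qpoch_oo q = pr mu [set gs n].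
  by rewrite N_event_pinned (pr_pinned_nil hq hmu).
rewrite (prob_positions hq hmu hsys hstat ht hxi).
set A := q ^ (- _).
rewrite -/(qpoch q d).
have A0 : 0 < A by rewrite exprz_gt0.
(* Positivity of (q;q)_oo is read off from [gE] rather than estimated. *)
have poo0 : 0 < qpoch_oo q.
  by have := g0; rewrite -gE pmulr_rgt0// lt_neqAle eq_sym prN0 pr_ge0.
have K0 : 0 < A * qpoch_oo q * qpoch q d by rewrite !mulr_gt0 ?qpoch_gt0.
have kE k := pr_positions_given_labels hq hmu n hd hm (k := k).
rewrite -ge0_esumZl; last 2 first.
(* The sign of a summand is that of the probability which it equals up to positive factors. *)
- move=> k [Zk /asboolP adm]; have := kE k Zk; rewrite adm => E.
  rewrite lee_fin -(pmulr_rge0 _ (mulr_gt0 A0 g0)) -E.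
  by rewrite !mulr_ge0 ?pr_ge0 ?invr_ge0 ?exprn_ge0// ltW// label_weight_gt0.
- exact: ltW.
rewrite (_ : [set k | _] = Zplus d `&` [set k : d.-tuple int | admissible d n m k])//.
rewrite (esum_mkcondr (Zplus d)); apply: eq_esum => k Zk.
have := kE k Zk; rewrite -[_ \in _]/(`[< admissible d n m k >]).
have -> : qpoch q d / q ^+ 'C(d, 2) / pr mu (N_event n) *
    (label_weight q k * pr mu (pinned n (zip m k))) =
    qpoch q d / pr mu (N_event n) *
    (pr mu (pinned n (zip m k)) * (q ^- 'C(d, 2) * label_weight q k)) by ring.
move=> ->; case: ifP => _; last by rewrite mulr0.
rewrite -EFinM; congr EFin; rewrite -/(summand q d n m k) -gE -/A.
by field.
Qed.
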